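(* Let $E$ be a symmetric space on $I=[0,\alpha)$ (with the Fatou property), where $\alpha=1$ or $\alpha=\infty$, with fundamental function $\phi$. Then the following conditions are equivalent. (i) $E$ is order continuous and, in case $\alpha=\infty$, for every $x\in E$, $\phi(s)x^{**}(s)\to0$ as $s\to\infty$. (ii) $E$ is $K$-order continuous and, in case $\alpha=\infty$, for every $x\in E$, $x^*(\infty)=0$.
   Context: Let $\mu$ be Lebesgue measure on $I=[0,\alpha)$, where $\alpha=1$ or $\alpha=\infty$, and let $L^0$ be the set of (equivalence classes of) extended real valued Lebesgue measurable functions on $I$. A Banach function space $E$ is a Banach lattice $(E,\|\cdot\|_E)$ which is a sublattice of $L^0$ such that: (1) if $x\in L^0$, $y\in E$ and $|x|\le|y|$ a.e., then $x\in E$ and $\|x\|_E\le\|y\|_E$; (2) there exists a strictly positive $x\in E$. $E^+=\{x\in E: x\ge 0\}$. $E$ has the Fatou property if whenever $(x_n)\subset E^+$, $\sup_n\|x_n\|_E<\infty$ and $x_n\uparrow x\in L^0$, then $x\in E$ and $\|x_n\|_E\uparrow\|x\|_E$. Standing assumption: $E$ has the Fatou property. For $x\in L^0$: the distribution function is $d_x(\lambda)=\mu\{s\in I:|x(s)|>\lambda\}$, $\lambda\ge0$; the decreasing rearrangement is $x^*(t)=\inf\{\lambda>0:d_x(\lambda)\le t\}$, $t\ge0$; the maximal function is $x^{**}(t)=\frac1t\int_0^t x^*(s)\,ds$, $t>0$. Convention: $x^*(\infty)=\lim_{t\to\infty}x^*(t)$ if $\alpha=\infty$, and $x^*(\infty)=0$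 if $\alpha=1$. A Banach function space $E$ is symmetric if whenever $x\in L^0$, $y\in E$ and $d_x=d_y$, then $x\in E$ and $\|x\|_E=\|y\|_E$. Its fundamental function is $\phi(t)=\|\chi_{(0,t)}\|_E$, $t\in[0,\alpha)$. For $x,y\in L^1+L^\infty$, $x\prec y$ iff $x^{**}(t)\le y^{**}(t)$ for all $t>0$. $x\in E$ is a point of order continuity of $E$ if for every sequence $(x_n)\subset E^+$ with $x_n\le|x|$ and $x_n\to0$ a.e. we have $\|x_n\|_E\to0$; $E$ is order continuous if every $x\in E$ is a point of order continuity. $x\in E$ is a point of $K$-order continuity of $E$ if for every sequence $(x_n)\subset E$ with $x_n\prec x$ for all $n$ and $x_n^*\to0$ a.e. we have $\|x_n\|_E\to0$; $E$ is $K$-order continuous if every $x\in E$ is a point of $K$-order continuity. *)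

(* Defs.v *)
From HB Require Import structures.
From mathcomp Require Import all_boot all_order all_algebra.
From mathcomp Require Import all_classical all_reals all_analysis.
From mathcomp Require Import measurable_realfun.
Set Implicit Arguments.
Unset Strict Implicit.
Unset Printing Implicit Defensive.
Import Order.TTheory GRing.Theory Num.Theory.
Import numFieldNormedType.Exports.

Local Open Scope classical_set_scope.
Local Open Scope ring_scope.
Local Open Scope ereal_scope.

Section Basics.
Context {R : realType}.
Implicit Types (alpha : \bar R) (x y : R -> \bar R).

(* I = [0, alpha); functions on I are total functions on R whose values
   outside I are never used. *)
Definition dom alpha : set R := [set t | (0 <= t)%R /\ t%:E < alpha].

Definition ae_on alpha (P : R -> Prop) : Prop :=
  {ae (@lebesgue_measure R), forall t, dom alpha t -> P t}.

(* Classes of functions modulo a.e. equality are handled through their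
   representatives. Every class of Lebesgue measurable functions contains a
   Borel function, so Borel representatives are enough. *)
Definition L0 alpha : set (R -> \bar R) :=
  [set x : R -> \bar R | measurable_fun (dom alpha) x].

Definition distr alpha x (l : R) : \bar R :=
  lebesgue_measure [set s | dom alpha s /\ l%:E < `|x s|].

Definition rearr alpha x (t : R) : \bar R :=
  ereal_inf [set l%:E | l in [set l : R | (0 < l)%R /\ distr alpha x l <= t%:E]].

Definition maxfun alpha x (t : R) : \bar R :=
  (t^-1)%:E * \int[lebesgue_measure]_(s in `[0%R, t]%classic) rearr alpha x s.

Definition rearr_infty alpha x : \bar R :=
  if alpha == +oo then lim (rearr alpha x t @[t --> +oo%R]) else 0.

Definition submaj alpha x y : Prop :=
  forall t : R, (0 < t)%R -> maxfun alpha x t <= maxfun alpha y t.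

End Basics.

(* A space is given by the set E of all representatives of its elements and by
   its norm N, which is relevant on E only. That E and N respect a.e. equality
   is a consequence of bfs_ideal. *)
Record banach_function_space (R : realType) (alpha : \bar R)
    (E : set (R -> \bar R)) (N : (R -> \bar R) -> R) : Prop := {
  bfs_L0 : E `<=` L0 alpha ;
  (* needed for E to be a vector space, as oo - oo must not occur *)
  bfs_fin : forall x, E x -> ae_on alpha (fun t => x t \is a fin_num) ;
  bfs_add : forall x y, E x -> E y -> E (fun t => x t + y t) ;
  bfs_scale : forall (a : R) x, E x -> E (fun t => a%:E * x t) ;
  bfs_max : forall x y, E x -> E y -> E (fun t => maxe (x t) (y t)) ;
  bfs_min : forall x y, E x -> E y -> E (fun t => mine (x t) (y t)) ;
  bfs_norm_ge0 : forall x, E x -> (0 <= N x)%R ;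
  bfs_norm_eq0 : forall x, E x -> N x = 0%R -> ae_on alpha (fun t => x t = 0) ;
  bfs_normZ : forall (a : R) x, E x ->
    N (fun t => a%:E * x t) = (`|a| * N x)%R ;
  bfs_normD : forall x y, E x -> E y ->
    (N (fun t => (x t + y t)%E) <= N x + N y)%R ;
  bfs_complete : forall x_ : nat -> R -> \bar R, (forall n, E (x_ n)) ->
    (forall e : R, (0 < e)%R -> exists n0 : nat, forall m n : nat,
      (n0 <= m)%N -> (n0 <= n)%N ->
      (N (fun t => (x_ m t - x_ n t)%E) < e)%R) ->
    exists2 x, E x &
      N (fun t => x_ n t - x t) @[n --> \oo] --> (0%R : R) ;
  (* this includes that N is a lattice norm *)
  bfs_ideal : forall x y, L0 alpha x -> E y ->
    ae_on alpha (fun t => `|x t| <= `|y t|) -> E x /\ (N x <= N y)%R ;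
  bfs_pos : exists2 x, E x & ae_on alpha (fun t => 0 < x t)
}.

Section Properties.
Context {R : realType}.
Variables (alpha : \bar R) (E : set (R -> \bar R)) (N : (R -> \bar R) -> R).
Implicit Types x y : R -> \bar R.

Definition pos_cone : set (R -> \bar R) :=
  [set x | E x /\ ae_on alpha (fun t => 0 <= x t)].

Definition fatou_property : Prop :=
  forall (x_ : nat -> R -> \bar R) x, (forall n, pos_cone (x_ n)) -> L0 alpha x ->
    (exists C : R, forall n, (N (x_ n) <= C)%R) ->
    ae_on alpha (fun t => nondecreasing_seq (fun n => x_ n t) /\
                          x_ n t @[n --> \oo] --> x t) ->
    [/\ E x, nondecreasing_seq (fun n => N (x_ n)) &
        N (x_ n) @[n --> \oo] --> N x].

Definition symmetric_space : Prop :=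
  banach_function_space alpha E N /\
  forall x y, L0 alpha x -> E y ->
    (forall l : R, (0 <= l)%R -> distr alpha x l = distr alpha y l) ->
    E x /\ N x = N y.

Definition fundamental (t : R) : R :=
  N (fun s => (\1_(`]0%R, t[%classic) s)%:E).

Definition oc_point x : Prop :=
  forall x_ : nat -> R -> \bar R, (forall n, pos_cone (x_ n)) ->
    (forall n, ae_on alpha (fun t => x_ n t <= `|x t|)) ->
    ae_on alpha (fun t => x_ n t @[n --> \oo] --> 0) ->
    N (x_ n) @[n --> \oo] --> (0%R : R).

Definition order_continuous : Prop := forall x, E x -> oc_point x.

Definition Koc_point x : Prop :=
  forall x_ : nat -> R -> \bar R, (forall n, E (x_ n)) ->
    (forall n, submaj alpha (x_ n) x) ->
    ae_on alpha (fun t => rearr alpha (x_ n) t @[n --> \oo] --> 0) ->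
    N (x_ n) @[n --> \oo] --> (0%R : R).

Definition K_order_continuous : Prop := forall x, E x -> Koc_point x.

End Properties.

(* Main.v *)
(* Every [x] in [E] has the same norm as its decreasing rearrangement [x^*], so
   both conditions can be read on decreasing functions.

   (ii) => (i): if [0 <= x_n <= |x|] and [x_n -> 0], then [x_n] is submajorized
   by [x], and [x_n^* -> 0] by dominated convergence, the superlevel sets of [x]
   having finite measure because [x^*(oo) = 0].  If [s_n -> oo], the functions
   [x^**(s_n) chi_(0, s_n)] are submajorized by [x], their rearrangements tend
   to 0, and their norms are [phi(s_n) x^**(s_n)].

   (i) => (ii): let [x_n] be submajorized by [x].  For [0 < h < K], bound [x_n^*]
   by [x_n^* chi_(0, h) + x_n^*(h) chi_(0, K) + x_n^* chi_(K, oo)].  The first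
   term is submajorized by [x^* chi_(0, h)], the last one by
   [x^**(K) chi_(0, K) + x^* chi_(K, oo)]; both bounds have small norm for [h]
   small and [K] large, and then the middle term tends to 0.

   Monotonicity of the norm under submajorization of decreasing functions is
   proved, under order continuity, by comparing step functions on a fine grid:
   there it reduces to the Hardy-Littlewood-Polya theorem for vectors.  The same
   comparison gives [phi(h) x^**(h) <= ||x^* chi_(0, h)||], hence
   [x^**(h) < oo]. *)

Require Import Defs.
From HB Require Import structures.
From mathcomp Require Import all_boot all_order all_algebra.
From mathcomp Require Import all_classical all_reals all_analysis.
From mathcomp Require Import measurable_realfun.
From mathcomp Require Import perm ring lra.
Set Implicit Arguments.
Unset Strict Implicit.
Unset Printing Implicit Defensive.
Import Order.TTheory GRing.Theory Num.Theory.
Import numFieldNormedType.Exports.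
Local Open Scope classical_set_scope.
Local Open Scope ring_scope.
Local Open Scope ereal_scope.

(** * Majorization of vectors *)

(* Induction on the number of indices where [a] and [b] differ.  Take the first
   [k] with [b k < a k] and the last [j < k] with [a j < b j].  Moving mass from
   [j] to [k] turns [b] into a convex combination of [b] and one of its
   transpositions, keeps its partial sums above those of [a], and makes it agree
   with [a] at [j] or at [k]. *)
Lemma majorization_le (R : realFieldType) m (p : ('I_m -> R) -> R)
    (p_conv : forall (s : R) u v, (0 <= s <= 1)%R ->
      (p (fun i => s * u i + (1 - s) * v i) <= s * p u + (1 - s) * p v)%R)
    (p_perm : forall (s : {perm 'I_m}) u, p (u \o s) = p u)
    (p_mono : forall u v, (forall i, 0 <= u i <= v i)%R -> (p u <= p v)%R)
    (a b : 'I_m -> R) :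
  (forall i j : 'I_m, (i <= j)%N -> a j <= a i)%R ->
  (forall i, 0 <= a i)%R -> (forall i, 0 <= b i)%R ->
  (forall i : nat, (i <= m)%N ->
     \sum_(j < m | (j < i)%N) a j <= \sum_(j < m | (j < i)%N) b j)%R ->
  (p a <= p b)%R.
Proof.
move=> a_decr a0.
have [n] := ubnP #|[pred i | a i != b i]|.
elim: n b => // n IHn b ltn b0 ab.
case: (pickP [pred i | (b i < a i)%R]) => [k1 /= k1P|ale]; last first.
  by apply: p_mono => i; rewrite a0 /= leNgt; have /= -> := ale i.
case: (@arg_minnP _ k1 [pred i | (b i < a i)%R] (@nat_of_ord m) k1P) => k /= bka kmin.
have leab (i : 'I_m) : (i < k)%N -> (a i <= b i)%R.
  by move=> ik; rewrite leNgt; apply/negP => /kmin; rewrite leqNgt ik.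
have sum_split (v : 'I_m -> R) : (\sum_(j < m | (j < k.+1)%N) v j =
    \sum_(j < m | (j < k)%N) v j + v k)%R.
  rewrite (bigD1 k) //= addrC; congr (_ + _)%R; apply: eq_bigl => i.
  by rewrite ltnS ltn_neqAle andbC.
case: (pickP [pred i : 'I_m | (i < k)%N && (a i < b i)%R]) => [j1 /= j1P|noj]; last first.
  (* Without such a [j], [a] and [b] agree before [k], and the partial sums up to [k + 1] give
     [a k <= b k]. *)
  have := ab k.+1 (ltn_ord k); rewrite !sum_split.
  have -> : (\sum_(j < m | (j < k)%N) b j = \sum_(j < m | (j < k)%N) a j)%R.
    apply: eq_bigr => i ik; apply/eqP; rewrite eq_le (leab _ ik) andbT leNgt.
    by apply/negP => h; have /= := noj i; rewrite ik h.
  by rewrite lerD2l leNgt bka.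
have [j /= /andP[jk abj] jmax] := @arg_maxnP _ j1
  [pred i : 'I_m | (i < k)%N && (a i < b i)%R] (@nat_of_ord m) j1P.
have jNk : (j != k) by rewrite neq_ltn jk.
pose d := Num.min (b j - a j)%R (a k - b k)%R.
have d0 : (0 < d)%R by rewrite lt_min !subr_gt0 abj.
have dj : (d <= b j - a j)%R by rewrite ge_min lexx.
have dk : (d <= a k - b k)%R by rewrite ge_min lexx orbT.
have akj : (a k <= a j)%R by apply: a_decr; exact: ltnW.
pose b' i := (b i + (if i == k then d else 0) - (if i == j then d else 0))%R.
have b'E i : b' i = (b i + (if i == k then d else 0) - (if i == j then d else 0))%R by [].
have b'j : (b' j = b j - d)%R by rewrite b'E eqxx (negbTE jNk); ring.
have b'k : (b' k = b k + d)%R by rewrite b'E eqxx eq_sym (negbTE jNk); ring.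
have b'o i : i != j -> i != k -> b' i = b i.
  by move=> ij ik; rewrite b'E (negbTE ij) (negbTE ik) addr0 subr0.
apply: (@le_trans _ _ (p b')).
  apply: IHn.
  - rewrite -ltnS; apply: leq_trans ltn; rewrite ltnS; apply: proper_card.
    apply/properP; split.
      apply/fintype.subsetP => i; rewrite !inE; have [->|ij] := eqVneq i j.
        by move=> _; rewrite lt_eqF.
      have [->|ik] := eqVneq i k; first by rewrite (gt_eqF bka).
      by rewrite b'o.
    have : (d == b j - a j)%R || (d == a k - b k)%R.
      by rewrite /d; case: leP => _; rewrite eqxx ?orbT.
    case/orP => /eqP dE; [exists j; rewrite !inE|exists k; rewrite !inE].
    - by rewrite lt_eqF.
    - by rewrite b'j dE opprB addrC subrK eqxx.
    - by rewrite gt_eqF.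
    - by rewrite b'k dE addrC subrK eqxx.
  - move=> i; have [->|ij] := eqVneq i j.
      by rewrite b'j; have := a0 j; lra.
    by rewrite b'E (negbTE ij) subr0 addr_ge0//; case: ifP => // _; exact: ltW.
  - move=> i im; rewrite (eq_bigr _ (fun i _ => b'E i)) !big_split /=.
    have dlt (l : 'I_m) :
        (\sum_(q < m | (q < i)%N) (if q == l then d else 0) = if (l < i)%N then d else 0)%R.
      case: ifPn => li; last first.
        apply: big1 => q qi; case: eqP => // ql; by rewrite -ql qi in li.
      rewrite (bigD1 l) //= eqxx big1 ?addr0// => q /andP[_ /negbTE ->] //.
    rewrite sumrN !dlt; case: ifPn => ki.
      by rewrite (ltn_trans jk ki) addrK ab.
    case: ifPn => ji; last by rewrite addr0 subr0 ab.
    rewrite -leqNgt in ki.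
    (* Here [j < i <= k]: all differences [b q - a q] with [q < k] are nonnegative, and the one at
       [j] is at least [d], the mass removed. *)
    rewrite addr0 -subr_ge0 addrAC -sumrB (bigD1 j) //=.
    rewrite addrAC addr_ge0 ?subr_ge0//.
    by apply: sumr_ge0 => q /andP[qi _]; rewrite subr_ge0 leab// (leq_trans qi).
have ljk : (0 < b j - b k)%R by lra.
(* Since [1 - s = d / (b j - b k)], mixing with the transposed vector moves exactly [d] from [j] to
   [k]; [a k <= a j] ensures [d <= b j - b k]. *)
pose s := ((b j - b k - d) / (b j - b k))%R.
have s01 : (0 <= s <= 1)%R.
  by rewrite /s divr_ge0 ?(ltW ljk)//= ?ler_pdivrMr//; lra.
have -> : b' = (fun i => s * b i + (1 - s) * (b \o tperm j k) i)%R.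
  apply: funext => i /=; have nz : (b j - b k)%R != 0%R by rewrite gt_eqF.
  case: tpermP => [->|->|/eqP ij /eqP ik].
  - by rewrite b'j /s; field.
  - by rewrite b'k /s; field.
  - by rewrite b'o//; ring.
apply: le_trans (p_conv _ _ _ s01) _.
by rewrite p_perm -mulrDl addrC subrK mul1r.
Qed.

(** * Decreasing functions and rearrangements *)

Section Decreasing.
Context {R : realType}.
Notation mu := (@lebesgue_measure R).
Implicit Types (f : R -> \bar R) (s t h : R).

(** Both conditions are on the whole line, not on I: [rearr] meets them, being +oo at negative
    arguments. *)
Definition decr f : Prop :=
  (forall t, 0 <= f t) /\ (forall s t, (s <= t)%R -> f t <= f s).

Lemma decr_measurable f (D : set R) : decr f -> measurable_fun D f.
Proof.
move=> [_ f_decr]; apply: measurable_funTS.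
apply: (measurability _ (ErealGenOInfty.measurableE R)) => _ [_ [x ->] <-].
rewrite setTI; apply: is_interval_measurable => s t /=.
rewrite !in_itv/= !andbT => _ xft z /andP[_ zt]; rewrite in_itv/= andbT.
exact: lt_le_trans xft (f_decr _ _ zt).
Qed.

Lemma decr_integral_ge0 f (D : set R) : decr f -> 0 <= \int[mu]_(x in D) f x.
Proof. by move=> [f0 _]; exact: integral_ge0. Qed.

(** The left end is an arbitrary bound, to serve integrals over [0, t] and over ]h, t] alike. *)
Lemma decr_integral_split f (a : itv_bound R) s t : decr f ->
  (a <= BRight s)%O -> (s <= t)%R ->
  \int[mu]_(x in [set` Interval a (BRight t)]) f x =
  \int[mu]_(x in [set` Interval a (BRight s)]) f x + \int[mu]_(x in `]s, t]) f x.
Proof.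
move=> f_decr as_ st.
have -> : [set` Interval a (BRight t)] =
    [set` Interval a (BRight s)] `|` `]s, t]%classic.
  by rewrite -itv_bndbnd_setU// bnd_simp.
rewrite ge0_integral_setU//; first exact: decr_measurable.
- by move=> x _; exact: f_decr.1.
- rewrite disj_set2E; apply/eqP; rewrite -subset0 => x [] /=.
  by rewrite !itv_boundlr/= !bnd_simp => /andP[_ xs] /andP[]; rewrite ltNge xs.
Qed.

Lemma mu_oc s t : (s <= t)%R -> mu `]s, t] = (t - s)%:E.
Proof.
move=> st; rewrite lebesgue_measure_itv/= lte_fin.
by case: ltgtP st => // -> _; rewrite subrr.
Qed.

Lemma decr_integral_le f s t : decr f -> (s <= t)%R ->
  \int[mu]_(x in `]s, t]) f x <= (t - s)%:E * f s.
Proof.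
move=> f_decr st.
rewrite muleC -(mu_oc st) -integral_cst//; apply: ge0_le_integral => //.
- by move=> x _; exact: f_decr.1.
- exact: decr_measurable.
- by move=> x /=; rewrite in_itv/= => /andP[/ltW sx _]; exact: f_decr.2.
Qed.

Lemma decr_integral_ge f s t : decr f -> (s <= t)%R ->
  (t - s)%:E * f t <= \int[mu]_(x in `]s, t]) f x.
Proof.
move=> f_decr st.
rewrite muleC -(mu_oc st) -integral_cst//; apply: ge0_le_integral => //.
- by move=> x _; exact: f_decr.1.
- exact: decr_measurable.
- by move=> x /=; rewrite in_itv/= => /andP[_ xt]; exact: f_decr.2.
Qed.

Lemma decr_integral0_ge f t : decr f -> (0 <= t)%R ->
  t%:E * f t <= \int[mu]_(x in `[0%R, t]) f x.
Proof.
move=> f_decr t0; rewrite -integral_itv_obnd_cbnd; last exact: decr_measurable.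
by have := decr_integral_ge f_decr t0; rewrite subr0.
Qed.

Lemma decr_sum_le f h (a : nat -> R) i : decr f -> (0 <= h)%R ->
  (forall j, (j < i)%N -> (a j)%:E <= f (h * j.+1%:R)%R) ->
  (h * \sum_(j < i) a j)%:E <= \int[mu]_(x in `[0%R, (h * i%:R)%R]) f x.
Proof.
move=> f_decr h0; elim: i => [|i IHi] af.
  by rewrite big_ord0 mulr0; exact: decr_integral_ge0.
rewrite (@decr_integral_split _ _ (h * i%:R)%R)//; last 2 first.
- by rewrite bnd_simp mulr_ge0.
- by rewrite ler_wpM2l// ler_nat.
rewrite big_ord_recr/= mulrDr EFinD leeD//.
  by apply: IHi => j ji; apply: af; exact: ltnW.
have le : (h * i%:R <= h * i.+1%:R)%R by rewrite ler_wpM2l// ler_nat.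
apply: le_trans (decr_integral_ge f_decr le).
rewrite -mulrBr -natrB// subSnn mulr1 EFinM.
by rewrite lee_wpmul2l ?lee_fin ?af.
Qed.

(** A sample at the right end of a cell bounds [f] from above on the next cell only, so the integral
    starts at [h]; near 0 [f] may be unbounded. *)
Lemma decr_sum_ge f h (a : nat -> R) i : decr f -> (0 <= h)%R ->
  (forall j, (j < i)%N -> f (h * j.+1%:R)%R <= (a j)%:E) ->
  \int[mu]_(x in `]h, (h * i.+1%:R)%R]) f x <= (h * \sum_(j < i) a j)%:E.
Proof.
move=> f_decr h0; elim: i => [|i IHi] af.
  by rewrite big_ord0 mulr0 mulr1 set_itv_ge ?integral_set0// bnd_simp ltxx.
have le : (h * i.+1%:R <= h * i.+2%:R)%R by rewrite ler_wpM2l// ler_nat.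
rewrite (@decr_integral_split _ _ (h * i.+1%:R)%R (h * i.+2%:R)%R)//; last first.
  by rewrite bnd_simp ler_peMr// ler1n.
rewrite big_ord_recr/= (mulrDr h (\sum_(j < i) a j)%R) EFinD leeD//.
  by apply: IHi => j ji; apply: af; exact: ltnW.
apply: le_trans (decr_integral_le f_decr le) _.
rewrite -mulrBr -natrB// subSnn mulr1 EFinM.
by rewrite lee_wpmul2l ?lee_fin ?af.
Qed.

End Decreasing.

(** * Almost everywhere statements on I *)

Section AlmostEverywhere.
Context {R : realType} (alpha : \bar R).
Notation mu := (@lebesgue_measure R).
Implicit Types P Q : R -> Prop.

Let ae_filter : Filter (almost_everywhere mu).
Proof. exact: ae_filter_ringOfSetsType. Qed.

Lemma ae_onW P : (forall t, dom alpha t -> P t) -> ae_on alpha P.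
Proof. by move=> IP; apply: (aeW (@lebesgue_measure R)) => t; exact: IP. Qed.

Lemma ae_on_imp P Q : (forall t, dom alpha t -> P t -> Q t) ->
  ae_on alpha P -> ae_on alpha Q.
Proof.
by move=> PQ; apply: (@filterS _ _ ae_filter) => t Pt It; exact: PQ (Pt It).
Qed.

Lemma ae_on_and P Q : ae_on alpha P -> ae_on alpha Q ->
  ae_on alpha (fun t => P t /\ Q t).
Proof.
by apply: (@filterS2 _ _ ae_filter) => t Pt Qt It; split; [exact: Pt|exact: Qt].
Qed.

Lemma ae_on_forall (P : nat -> R -> Prop) : (forall n, ae_on alpha (P n)) ->
  ae_on alpha (fun t => forall n, P n t).
Proof.
by move=> /ae_foralln; apply: (@filterS _ _ ae_filter) => t + It n; exact.
Qed.

(** Points are null. This serves to discard [t = 0], where a rearrangement may be infinite. *)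
Lemma ae_on_neq (a : R) P : (forall t, dom alpha t -> t != a -> P t) ->
  ae_on alpha P.
Proof.
move=> aP; exists [set a]; split => //; first exact: lebesgue_measure_set1.
move=> t /= nP; apply: contrapT => /eqP ta; apply: nP => It; exact: aP.
Qed.

Lemma ae_on_exists (a b : R) P : (0 <= a)%R -> (a < b)%R -> b%:E <= alpha ->
  ae_on alpha P -> exists2 t, (a < t < b)%R & P t.
Proof.
move=> a0 ab b_alpha [M [mM M0 PM]]; apply: contrapT => noP.
have : mu `]a, b[ <= mu M.
  apply: le_measure; rewrite ?inE// => t /=; rewrite in_itv/= => tab.
  apply: PM => /= Pt; apply: noP; exists t => //; apply: Pt; split.
    by case/andP: tab => at_ _; rewrite (le_trans a0) ?ltW.
  by case/andP: tab => _ tb; apply: lt_le_trans b_alpha; rewrite lte_fin.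
by rewrite M0 lebesgue_measure_itv/= lte_fin ab -EFinB lee_fin subr_le0 leNgt ab.
Qed.

End AlmostEverywhere.

(** * Distribution function and decreasing rearrangement *)

Section Rearrangement.
Context {R : realType} (alpha : \bar R).
Notation mu := (@lebesgue_measure R).
Implicit Types (x y : R -> \bar R) (t l : R).

Lemma measurable_dom : measurable (dom alpha).
Proof.
apply: is_interval_measurable => s t [s0 _] [_ t_alpha] z /andP[sz zt].
split; first exact: le_trans sz.
by apply: le_lt_trans t_alpha; rewrite lee_fin.
Qed.

Lemma measurable_superlevel x l : L0 alpha x ->
  measurable [set s | dom alpha s /\ l%:E < `|x s|].
Proof.
move=> mx.
have := measurableT_comp (@abse_measurable R setT) mx.
move=> /(_ measurable_dom `]l%:E, +oo[%classic).
have -> : dom alpha `&` (abse \o x) @^-1` `]l%:E, +oo[%classic =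
    [set s | dom alpha s /\ l%:E < `|x s|].
  by apply/seteqP; split => s /=; rewrite in_itv/= andbT.
by apply; exact: emeasurable_itv.
Qed.

Lemma ae_le_measure (A B : set R) : measurable A -> measurable B ->
  ae_on alpha (fun s => A s -> B s) -> A `<=` dom alpha -> mu A <= mu B.
Proof.
move=> mA mB [M [mM M0 AB]] AI.
apply: (@le_trans _ _ (mu (B `|` M))).
  apply: le_measure; rewrite ?inE//; first exact: measurableU.
  move=> s As; have [Bs|Bs] := pselect (B s); [by left|right].
  by apply: AB => /(_ (AI _ As) As).
by rewrite measureU0.
Qed.

Lemma distr_ge0 x l : 0 <= distr alpha x l.
Proof. exact: measure_ge0. Qed.

Lemma distr_decr x l l' : L0 alpha x -> (l <= l')%R ->
  distr alpha x l' <= distr alpha x l.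
Proof.
move=> mx ll'; apply: le_measure; rewrite ?inE; try exact: measurable_superlevel.
by move=> s /= [Is xs]; split=> //; apply: le_lt_trans xs; rewrite lee_fin.
Qed.

(** Continuity of the measure from below: the superlevel sets at [l + 1/(n+1)] increase to the one
    at [l]. *)
Lemma distr_cvg x l : L0 alpha x ->
  distr alpha x (l + n.+1%:R^-1) @[n --> \oo] --> distr alpha x l.
Proof.
move=> mx.
pose F n := [set s | dom alpha s /\ (l + n.+1%:R^-1)%:E < `|x s|].
have FE : \bigcup_n F n = [set s | dom alpha s /\ l%:E < `|x s|].
  apply/seteqP; split => s /=.
    move=> [n _ [Is xs]]; split => //; apply: le_lt_trans xs.
    by rewrite lee_fin lerDl.
  move=> [Is]; case E : `|x s| => [r| |].
  - rewrite lte_fin => /ltr_add_invr[k kr]; exists k => //; split => //.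
    by rewrite E lte_fin.
  - by move=> _; exists 0%N => //; split=> //; rewrite E ltry.
  - by rewrite ltNge leNye.
rewrite /distr -FE; apply: nondecreasing_cvg_mu.
- by move=> n; exact: measurable_superlevel.
- by rewrite FE; exact: measurable_superlevel.
- move=> m n mn; apply/subsetPset => s [Is xs]; split=> //.
  apply: le_lt_trans xs; rewrite lee_fin lerD2l lef_pV2 ?posrE// ler_nat.
  by rewrite ltnS.
Qed.

(** The distribution function is decreasing and right continuous, so it and [x^*] are generalized
    inverses of each other, level 0 included. *)
Lemma rearr_leP x t l : L0 alpha x -> (0 <= l)%R ->
  (rearr alpha x t <= l%:E) = (distr alpha x l <= t%:E).
Proof.
move=> mx l0; apply/idP/idP => [le|le].
  apply: (cvge_to_le (distr_cvg (l := l) mx)); near=> n.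
  have /ereal_inf_lt[_ [l' [l'0 dl'] <-]] :
      rearr alpha x t < (l + n.+1%:R^-1)%:E.
    by apply: le_lt_trans le _; rewrite lte_fin ltrDl.
  by rewrite lte_fin => /ltW/(distr_decr mx)/le_trans; apply.
apply/lee_addgt0Pr => e e0; apply: ereal_inf_lbound; exists (l + e)%R => //.
split; first exact: ltr_wpDl.
by apply: le_trans le; apply: distr_decr => //; rewrite lerDl ltW.
Unshelve. all: by end_near. Qed.

Lemma decr_rearr x : L0 alpha x -> decr (rearr alpha x).
Proof.
move=> mx; split=> [t|s t st].
  by apply/ereal_infP => _ [l [l0 _] <-]; rewrite lee_fin ltW.
apply: ereal_inf_le_tmp => _ [l [l0 dl] <-]; exists l => //; split => //.
by apply: le_trans dl _; rewrite lee_fin.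
Qed.

Lemma rearr_le_mono x y t : L0 alpha x -> L0 alpha y ->
  ae_on alpha (fun s => `|x s| <= `|y s|) -> rearr alpha x t <= rearr alpha y t.
Proof.
move=> mx my xy.
apply: ereal_inf_le_tmp => _ [l [l0 dl] <-]; exists l => //; split => //.
apply: le_trans dl; apply: ae_le_measure; try exact: measurable_superlevel.
  by apply: ae_on_imp xy => s Is xy [_ lx]; split => //; exact: lt_le_trans xy.
by move=> s [].
Qed.

(** For [l >= 0], [rearr_leP] turns [l < x^*(t)] into [t < d_x(l)], an open condition on [t]. *)
Lemma rearr_rlsc x t l : L0 alpha x -> l%:E < rearr alpha x t ->
  exists2 e : R, (0 < e)%R & l%:E < rearr alpha x (t + e).
Proof.
move=> mx; have [l0|l0] := ltP l 0%R => lx.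
  by exists 1%R => //; apply: lt_le_trans ((decr_rearr mx).1 _).
move: lx; rewrite ltNge rearr_leP// -ltNge => td.
suff [e e0 ed] : exists2 e : R, (0 < e)%R & (t + e)%:E < distr alpha x l.
  by exists e => //; rewrite ltNge rearr_leP// -ltNge.
case: (distr alpha x l) td => [d| |]//.
- rewrite lte_fin => td; exists ((d - t) / 2)%R; first by lra.
  by rewrite lte_fin; lra.
- by move=> _; exists 1%R => //; exact: ltry.
Qed.

Hypothesis alpha0 : 0 <= alpha.

Lemma mu_halfline (d : \bar R) : 0 <= d ->
  mu [set s | (0 <= s)%R /\ s%:E < d] = d.
Proof.
case: d => [d| |]// d0.
- have -> : [set s | (0 <= s)%R /\ s%:E < d%:E] = `[0%R, d[%classic.
    by apply/seteqP; split=> s /=; rewrite in_itv/= lte_fin => /andP.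
  rewrite lebesgue_measure_itv/= lte_fin; rewrite lee_fin in d0.
  by case: ltgtP d0 => // [|<-//]; rewrite sube0.
- have -> : [set s : R | (0 <= s)%R /\ s%:E < +oo] = `[0%R, +oo[%classic.
    apply/seteqP; split=> s /=; rewrite in_itv/= andbT; first by case.
    by rewrite ltry.
  by rewrite lebesgue_measure_itv/= ltry.
Qed.

Lemma distr_le_alpha x l : L0 alpha x -> distr alpha x l <= alpha.
Proof.
move=> mx; rewrite -[leRHS](mu_halfline alpha0); apply: le_measure; rewrite ?inE.
- exact: measurable_superlevel.
- exact: measurable_dom.
- by move=> s [].
Qed.

(** By [rearr_leP] the superlevel set of [x^*] is the interval [0, d_x(l)), which lies in I because
    [d_x(l) <= alpha]. *)
Lemma distr_rearr x l : L0 alpha x -> (0 <= l)%R ->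
  distr alpha (rearr alpha x) l = distr alpha x l.
Proof.
move=> mx l0; rewrite -[RHS](mu_halfline (distr_ge0 x l)) /distr.
congr (mu _); apply/seteqP; split=> s /=.
- rewrite gee0_abs; last exact: (decr_rearr mx).1.
  by move=> [[s0 _]]; rewrite ltNge rearr_leP// -ltNge.
- move=> [s0 sd]; split; first by split => //; exact: lt_le_trans sd (distr_le_alpha l mx).
  rewrite gee0_abs; last exact: (decr_rearr mx).1.
  by rewrite ltNge rearr_leP// -ltNge.
Qed.

Lemma L0_rearr x : L0 alpha x -> L0 alpha (rearr alpha x).
Proof. by move=> /decr_rearr; exact: decr_measurable. Qed.

End Rearrangement.

(** * Step functions *)

Section StepFunctions.
Context {R : realType}.
Notation mu := (@lebesgue_measure R).
Implicit Types (h t : R).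

Definition cell h (j : nat) : set R := `[(h * j%:R)%R, (h * j.+1%:R)%R[%classic.

Definition step h m (v : 'I_m -> R) (t : R) : \bar R :=
  (\sum_(j < m) v j * \1_(cell h j) t)%:E.

(** The point 0 belongs to the interval, unlike in [fundamental], so that these indicators are step
    functions on the grid of cells. *)
Definition ind (h t : R) : \bar R := (\1_(`[0%R, h[%classic) t)%:E.

(** There is no cut at negative arguments, so that truncation preserves [decr]. *)
Definition trunc (h : R) (f : R -> \bar R) (t : R) : \bar R :=
  if (t < h)%R then f t else 0.

Lemma indE h t : ind h t = if ((0 <= t) && (t < h))%R then 1 else 0.
Proof. by rewrite /ind indicE mem_setE in_itv/=; case: ifP. Qed.

Lemma measurable_ind h (D : set R) : measurable_fun D (ind h).
Proof. by apply/measurable_EFinP; exact: measurable_indic. Qed.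

Lemma measurable_step h m (v : 'I_m -> R) (D : set R) :
  measurable_fun D (step h v).
Proof.
apply/measurable_EFinP; apply: measurable_sum => j.
apply: measurable_funM; first exact: measurable_cst.
by apply: measurable_indic; rewrite /cell.
Qed.

Lemma decr_trunc h f : decr f -> decr (trunc h f).
Proof.
move=> [f0 f_decr]; split=> [t|s t st]; rewrite /trunc; first by case: ifP.
case: ifPn => th; last by case: ifP.
by rewrite (le_lt_trans st th) f_decr.
Qed.

Lemma cell_exists h t : (0 < h)%R -> (0 <= t)%R -> exists j, cell h j t.
Proof.
move=> h0 t0; have /truncn_itv : (0 <= t / h)%R by rewrite divr_ge0// ltW.
move=> /andP[lt gt]; exists (Num.truncn (t / h)); rewrite /cell/= in_itv/=.
by rewrite mulrC -ler_pdivlMr// lt mulrC -ltr_pdivrMr.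
Qed.

Lemma cell_inj h t i j : (0 < h)%R -> cell h i t -> cell h j t -> i = j.
Proof.
move=> h0; rewrite /cell/= !in_itv/= => /andP[it ti] /andP[jt tj].
have := le_lt_trans it tj; have := le_lt_trans jt ti.
rewrite !ltr_pM2l// !ltr_nat !ltnS => ji ij.
by apply/eqP; rewrite eqn_leq ij ji.
Qed.

Lemma mem_cell h j t : (0 < h)%R -> cell h j t -> (0 <= t)%R.
Proof.
by move=> h0; rewrite /cell/= in_itv/= => /andP[+ _]; apply: le_trans; rewrite mulr_ge0// ltW.
Qed.

Lemma cell_lt h j t m : (0 < h)%R -> cell h j t -> (j < m)%N = (t < h * m%:R)%R.
Proof.
move=> h0; rewrite /cell/= in_itv/= => /andP[jt tj]; apply/idP/idP => [jm|tm].
  by apply: lt_le_trans tj _; rewrite ler_pM2l// ler_nat.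
by have := le_lt_trans jt tm; rewrite ltr_pM2l// ltr_nat.
Qed.

Lemma step_cell h m (v : 'I_m -> R) (j : 'I_m) t : (0 < h)%R -> cell h j t ->
  step h v t = (v j)%:E.
Proof.
move=> h0 jt; rewrite /step (bigD1 j)//= indicE mem_set// mulr1 big1 ?addr0//.
move=> i ij; rewrite indicE memNset ?mulr0// => it.
by move/eqP: ij; apply; apply: val_inj; exact: cell_inj it jt.
Qed.

Lemma step_out h m (v : 'I_m -> R) t : (0 < h)%R ->
  ((t < 0) || (h * m%:R <= t))%R -> step h v t = 0.
Proof.
move=> h0 ht; rewrite /step big1// => j _; rewrite indicE memNset ?mulr0// => jt.
case/orP: ht; first by rewrite ltNge (mem_cell h0 jt).
by rewrite leNgt -(cell_lt m h0 jt) ltn_ord.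
Qed.

Lemma stepP h m (v : 'I_m -> R) t : (0 < h)%R ->
  (exists2 j : 'I_m, cell h j t & step h v t = (v j)%:E) \/
  (((t < 0) || (h * m%:R <= t))%R /\ step h v t = 0).
Proof.
move=> h0; have [t0|t0] := ltP t 0%R.
  by right; split => //; apply: step_out => //; rewrite t0.
have [tm|tm] := ltP t (h * m%:R)%R; last first.
  by right; split => //; apply: step_out => //; rewrite tm orbT.
have [j jt] := cell_exists h0 t0; left.
move: (tm); rewrite -(cell_lt _ h0 jt) => jm.
by exists (Ordinal jm) => //; exact: step_cell.
Qed.

Lemma mu_cell h j : (0 < h)%R -> mu (cell h j) = h%:E.
Proof.
move=> h0; rewrite /cell lebesgue_measure_itv/= lte_fin ltr_pM2l// ltr_nat ltnSn.
by rewrite -EFinB -mulrBr -natrB// subSnn mulr1.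
Qed.

(** The superlevel set is a disjoint union of cells of length [h]. The distribution function thus
    only counts entries and ignores their order. *)
Lemma distr_step alpha h m (v : 'I_m -> R) l : (0 < h)%R ->
  (h * m%:R)%:E <= alpha -> (0 <= l)%R ->
  distr alpha (step h v) l = (\sum_(j < m | (l < `|v j|)%R) h)%:E.
Proof.
move=> h0 hm l0; rewrite /distr.
have -> : [set s | dom alpha s /\ l%:E < `|step h v s|] =
    \big[setU/set0]_(j < m | (l < `|v j|)%R) cell h j.
  rewrite -bigcup_seq_cond; apply/seteqP; split => t.
    move=> [_]; case: (stepP v t h0) => [[j jt ->]|[_ ->]].
      by rewrite abse_EFin lte_fin => lv; exists j => //=; rewrite mem_index_enum.
    by rewrite abse0 lte_fin ltNge l0.
  move=> [j /andP[_ lv] jt]; split; last by rewrite (step_cell v h0 jt) abse_EFin lte_fin.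
  split; first exact: mem_cell jt.
  by apply: lt_le_trans hm; rewrite lte_fin -(cell_lt m h0 jt).
rewrite measure_bigsetU_ord_cond//.
- by rewrite -sumEFin; apply: eq_bigr => j _; exact: mu_cell.
- by move=> j _; rewrite /cell.
- by move=> i j _ _ [t [it jt]]; apply: val_inj; exact: cell_inj it jt.
Qed.

End StepFunctions.

(** * Symmetric spaces *)

Section SymmetricSpace.
Context {R : realType} {alpha : \bar R}.
Context {E : set (R -> \bar R)} {N : (R -> \bar R) -> R}.
Hypothesis halpha : alpha = 1 \/ alpha = +oo.
Hypothesis hE : symmetric_space alpha E N.
Notation mu := (@lebesgue_measure R).
Implicit Types (x y z f : R -> \bar R) (h t : R).

Let bfs : banach_function_space alpha E N := hE.1.

Lemma alpha_ge1 : 1 <= alpha.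
Proof. by case: halpha => ->; rewrite ?lexx// leey. Qed.

Let alpha_ge0 : 0 <= alpha.
Proof. exact: le_trans alpha_ge1. Qed.

Lemma space_le x y : L0 alpha x -> E y ->
  (forall t, dom alpha t -> `|x t| <= `|y t|) -> E x /\ (N x <= N y)%R.
Proof. by move=> mx Ey xy; apply: (bfs_ideal bfs) => //; exact: ae_onW. Qed.

Lemma space_eq_ae x y : L0 alpha x -> E y -> ae_on alpha (fun t => x t = y t) ->
  E x /\ N x = N y.
Proof.
move=> mx Ey xy.
have [Ex xley] : E x /\ (N x <= N y)%R.
  by apply: (bfs_ideal bfs) => //; apply: ae_on_imp xy => t _ ->.
split=> //; apply/eqP; rewrite eq_le xley /=.
have [] := bfs_ideal bfs (bfs_L0 bfs Ey) Ex => //.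
by apply: ae_on_imp xy => t _ ->.
Qed.

Lemma space_rearr x : E x -> E (rearr alpha x) /\ N (rearr alpha x) = N x.
Proof.
move=> Ex; have mx := bfs_L0 bfs Ex.
by apply: hE.2 => //; [exact: L0_rearr|move=> l l0; exact: distr_rearr].
Qed.

(** Elements of [E] are finite a.e., hence at some point of ]0, min(t, 1)[, which lies in I;
    monotonicity carries finiteness to [t], even beyond I. *)
Lemma decr_fin_num f t : decr f -> E f -> (0 < t)%R -> f t \is a fin_num.
Proof.
move=> [f0 f_decr] Ef t0.
have [] := @ae_on_exists _ alpha 0 (Num.min t 1)%R _ _ _ _ (bfs_fin bfs Ef) => //.
- by rewrite lt_min t0 ltr01.
- by apply: le_trans alpha_ge1; rewrite lee_fin ge_min lexx orbT.
- move=> s /andP[s0]; rewrite lt_min => /andP[st _] fs.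
  rewrite ge0_fin_numE//; apply: le_lt_trans (f_decr _ _ (ltW st)) _.
  by rewrite -ge0_fin_numE.
Qed.

Lemma decr_EFin_fine f t : decr f -> E f -> (0 < t)%R -> (fine (f t))%:E = f t.
Proof. by move=> f_decr Ef t0; rewrite fineK// decr_fin_num. Qed.

Lemma space_step_perm h m (v : 'I_m -> R) (s : {perm 'I_m}) : (0 < h)%R ->
  (h * m%:R)%:E <= alpha -> E (step h v) ->
  E (step h (v \o s)) /\ N (step h (v \o s)) = N (step h v).
Proof.
move=> h0 hm Ev; apply: hE.2 => // [|l l0]; first exact: measurable_step.
by rewrite !distr_step// [in RHS](reindex_inj (@perm_inj _ s)).
Qed.

(** For [T < alpha] a strictly positive [x] in [E] has [x^*(T) > 0], and [x^* / x^*(T)] dominates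
    the indicator of [0, T). *)
Lemma space_ind h : (0 < h)%R -> h%:E <= alpha -> E (ind h).
Proof.
have step_lt T : (0 < T)%R -> T%:E < alpha -> E (ind T).
  move=> T0 Ta; have [x Ex x_gt0] := bfs_pos bfs.
  have mx := bfs_L0 bfs Ex; have [rx_ge0 rx_decr] := decr_rearr mx.
  have : 0 < rearr alpha x T.
    rewrite ltNge rearr_leP// -ltNge; apply: lt_le_trans Ta _.
    rewrite -[leLHS](mu_halfline alpha_ge0); apply: ae_le_measure => //.
    - exact: measurable_dom.
    - exact: measurable_superlevel.
    - by apply: ae_on_imp x_gt0 => t It xt _; split => //; rewrite gee0_abs ?ltW.
    - by [].
  rewrite lt0e => /andP[rT_neq0 _].
  have rT : rearr alpha x T = (fine (rearr alpha x T))%:E.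
    by rewrite (decr_EFin_fine (decr_rearr mx) (space_rearr Ex).1).
  have r0 : (0 < fine (rearr alpha x T))%R.
    by rewrite lt_def fine_ge0// andbT; apply: contra rT_neq0 => /eqP; rewrite rT /= => ->.
  have Er := bfs_scale bfs (fine (rearr alpha x T))^-1 (space_rearr Ex).1.
  apply: (space_le _ Er _).1; first exact: measurable_ind.
  move=> t [t0 ta]; rewrite indE; case: ifPn => [/andP[_ tT]|_]; last by rewrite abse0.
  rewrite abseM !gee0_abs ?lee_fin ?invr_ge0 ?(ltW r0)//.
  rewrite -[leLHS](_ : (fine (rearr alpha x T))^-1%:E * (fine (rearr alpha x T))%:E = 1).
    by rewrite lee_wpmul2l ?lee_fin ?invr_ge0 ?(ltW r0)// -rT rx_decr// ltW.
  by rewrite -EFinM mulVf// gt_eqF.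
move=> h0 ha; have [|] := boolP (h%:E < alpha); first exact: step_lt.
rewrite -leNgt => ah; have {ah ha} ah : alpha = h%:E by apply/eqP; rewrite eq_le ha ah.
(* At [h = alpha] the value [x^*(h)] is 0. The indicator is instead the sum of those of its two
   halves: the first is covered by [step_lt], the second is its image under a transposition of
   cells. *)
pose d : R := (h / 2)%R; have d0 : (0 < d)%R by rewrite /d; lra.
pose e (i : 'I_2) : 'I_2 -> R := fun j => (i == j)%:R%R.
have e0E : step d (e ord0) = ind d.
  apply: funext => t; rewrite /step big_ord_recl big_ord1 /= /e eqxx mul1r mul0r addr0.
  by rewrite /cell mulr0 mulr1.
have E0 : E (step d (e ord0)).
  by rewrite e0E; apply: step_lt => //; rewrite ah lte_fin /d; lra.
have dh : (d * 2%:R)%:E <= alpha by rewrite ah lee_fin /d; lra.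
have [E1 _] := space_step_perm (tperm ord0 ord_max) d0 dh E0.
have := bfs_add bfs E0 E1; congr (E _); apply: funext => t.
rewrite -EFinD /step !big_ord_recl !big_ord0 /= /e /= ?eqxx.
have -> : lift ord0 ord0 = ord_max :> 'I_2 by apply: val_inj.
rewrite tpermL tpermR /= !mul1r !mul0r !addr0 !add0r /cell mulr0 mulr1.
rewrite /ind !indicE !mem_setE !in_itv/=.
have -> : (d * 2 = h)%R by rewrite /d; field.
have dlth : (d < h)%R by rewrite /d; lra.
have [t0|t0] := leP 0%R t; have [td|td] := ltP t d => /=; rewrite ?addr0 ?add0r//.
- by rewrite (lt_trans td).
- by have := lt_le_trans (lt_trans t0 d0) td; rewrite ltxx.
Qed.

Lemma N_ge0 x : E x -> (0 <= N x)%R.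
Proof. exact: bfs_norm_ge0 bfs x. Qed.

Lemma scale_ind h (c : R) : (0 < h)%R -> h%:E <= alpha -> (0 <= c)%R ->
  E (fun t => c%:E * ind h t) /\ N (fun t => c%:E * ind h t) = (c * N (ind h))%R.
Proof.
move=> h0 ha c0; have Eh := space_ind h0 ha; split; first exact: (bfs_scale bfs).
by rewrite (bfs_normZ bfs)// ger0_norm.
Qed.

Lemma space_step h m (v : 'I_m -> R) : (0 < h)%R ->
  (h * m%:R)%:E <= alpha -> E (step h v).
Proof.
move=> h0; case: m v => [|m] v hm.
  have -> : step h v = (fun t => 0%:E * ind 1 t).
    by apply: funext => t; rewrite /step big_ord0 mul0e.
  by apply: (bfs_scale bfs); apply: space_ind => //; exact: alpha_ge1.
have hm0 : (0 < h * m.+1%:R)%R by rewrite mulr_gt0.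
pose C : R := (\sum_(j < m.+1) `|v j|)%R.
have C0 : (0 <= C)%R by exact: sumr_ge0.
apply: (space_le _ (scale_ind hm0 hm C0).1 _).1; first exact: measurable_step.
move=> t [t0 ta]; case: (stepP v t h0) => [[j jt ->]|[_ ->]]; last by rewrite abse0.
rewrite indE t0 -(cell_lt m.+1 h0 jt) ltn_ord mule1 !abse_EFin lee_fin (ger0_norm C0).
by rewrite /C (bigD1 j)//= lerDl sumr_ge0.
Qed.

(** As a function of the vector of values, the norm of a step function is convex by the norm axioms,
    permutation invariant by symmetry, and monotone by the ideal property; [majorization_le]
    applies. *)
Lemma step_majorization h m (a b : nat -> R) : (0 < h)%R ->
  (h * m%:R)%:E <= alpha ->
  (forall i j, (i <= j)%N -> a j <= a i)%R -> (forall i, 0 <= a i)%R ->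
  (forall i, 0 <= b i)%R ->
  (forall i, (i <= m)%N -> \sum_(j < i) a j <= \sum_(j < i) b j)%R ->
  (N (step h (fun j : 'I_m => a j)) <= N (step h (fun j : 'I_m => b j)))%R.
Proof.
move=> h0 hm a_decr a0 b0 ab.
apply: (@majorization_le _ m (fun v => N (step h v))) => //.
- move=> s u v /andP[s0 s1].
  have Eu := space_step u h0 hm; have Ev := space_step v h0 hm.
  have -> : step h (fun i => s * u i + (1 - s) * v i)%R =
      (fun t => s%:E * step h u t + (1 - s)%:E * step h v t).
    apply: funext => t; rewrite /step -!EFinM -EFinD; congr EFin.
    by rewrite !mulr_sumr -big_split /=; apply: eq_bigr => j _; ring.
  apply: le_trans (bfs_normD bfs _ _) _; try exact: (bfs_scale bfs).
  rewrite !(bfs_normZ bfs)// !ger0_norm//; lra.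
- by move=> s u; apply: (space_step_perm _ _ _ _).2 => //; exact: space_step.
- move=> u v uv; apply: (space_le _ _ _).2; first exact: measurable_step.
    exact: space_step.
  move=> t _; case: (stepP u t h0) => [[j jt ->]|[_ ->]]; last by rewrite abse0.
  rewrite (step_cell v h0 jt) !abse_EFin lee_fin.
  by have /andP[u0 uvj] := uv j; rewrite !ger0_norm//; exact: le_trans uvj.
- by move=> i j ij; exact: a_decr.
- by move=> i im; rewrite !(big_ord_narrow im); exact: ab.
Qed.

(** The two indicators differ only at the point 0. *)
Lemma fundamentalE h : (0 < h)%R -> h%:E <= alpha -> fundamental N h = N (ind h).
Proof.
move=> h0 ha; apply: (space_eq_ae _ (space_ind h0 ha) _).2.
  by apply/measurable_EFinP; exact: measurable_indic.
apply: (@ae_on_neq _ _ 0%R) => t [t0 _] tneq0.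
rewrite indE indicE mem_setE in_itv/= t0 lt_def tneq0 t0 /=.
by case: ifP.
Qed.

Lemma fundamental_gt0 h : (0 < h)%R -> h%:E <= alpha -> (0 < fundamental N h)%R.
Proof.
move=> h0 ha; rewrite fundamentalE//; have Eh := space_ind h0 ha.
rewrite lt_def N_ge0// andbT; apply/eqP => /(bfs_norm_eq0 bfs Eh) ae0.
have [t /andP[t0 th]] := @ae_on_exists _ alpha 0 h _ (lexx _) h0 ha ae0.
by rewrite indE (ltW t0) th => /eqP; rewrite onee_eq0.
Qed.

Lemma fundamental_le s t : (0 < s)%R -> (s <= t)%R -> t%:E <= alpha ->
  (fundamental N s <= fundamental N t)%R.
Proof.
move=> s0 st ta; have sa : s%:E <= alpha by apply: le_trans ta; rewrite lee_fin.
have t0 : (0 < t)%R by exact: lt_le_trans st.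
rewrite !fundamentalE//; apply: (space_le _ (space_ind t0 ta) _).2.
  exact: measurable_ind.
move=> u _; rewrite !indE; case: ifPn => [/andP[-> us]|_]; last by rewrite abse0 abse_ge0.
by rewrite (lt_le_trans us st).
Qed.

Lemma space_trunc f h : decr f -> E f ->
  E (trunc h f) /\ (N (trunc h f) <= N f)%R.
Proof.
move=> f_decr Ef; apply: space_le => //.
  by apply: decr_measurable; exact: decr_trunc.
move=> t _; rewrite /trunc; case: ifP => // _.
by rewrite abse0.
Qed.

End SymmetricSpace.

(** * Averages of decreasing functions *)

(** Split the sum at [i]: earlier entries are at least [v i], later ones at most [v i]. This
    compares two means without division. *)
Lemma mean_decr (R : realFieldType) (v : nat -> R) i m :
  (forall i j, (i <= j)%N -> v j <= v i)%R -> (i <= m)%N ->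
  (i%:R * \sum_(j < m) v j <= m%:R * \sum_(j < i) v j)%R.
Proof.
move=> v_decr im.
have head : (i%:R * v i <= \sum_(j < i) v j)%R.
  rewrite mulr_natl -[X in (_ *+ X)%R]card_ord -sumr_const.
  by apply: ler_sum => j _; apply: v_decr; exact: ltnW.
have tail : (\sum_(i <= j < m) v j <= (m - i)%:R * v i)%R.
  rewrite mulr_natl -sumr_const_nat big_nat_cond [leRHS]big_nat_cond.
  by apply: ler_sum => j /andP[/andP[ij _] _]; exact: v_decr.
have -> : (\sum_(j < m) v j = \sum_(j < i) v j + \sum_(i <= j < m) v j)%R.
  by rewrite -!(big_mkord xpredT) -big_cat_nat.
have i0 : (0 <= i%:R :> R)%R by [].
have mi0 : (0 <= (m - i)%:R :> R)%R by [].
rewrite mulrDr -[in leRHS](subnKC im) natrD mulrDl lerD2l.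
apply: le_trans (ler_wpM2l i0 tail) _.
by rewrite mulrCA ler_wpM2l.
Qed.

Section Averaging.
Context {R : realType} {alpha : \bar R}.
Context {E : set (R -> \bar R)} {N : (R -> \bar R) -> R}.
Hypothesis halpha : alpha = 1 \/ alpha = +oo.
Hypothesis hE : symmetric_space alpha E N.
Notation mu := (@lebesgue_measure R).
Implicit Types (x y z f : R -> \bar R) (h t : R).

Let bfs : banach_function_space alpha E N := hE.1.

Lemma fine_grid_decr f h : decr f -> E f -> (0 < h)%R ->
  forall i j, (i <= j)%N ->
  (fine (f (h * j.+1%:R)) <= fine (f (h * i.+1%:R)))%R.
Proof.
move=> f_decr Ef h0 i j ij.
apply: fine_le; try by apply: (decr_fin_num halpha hE) => //; rewrite mulr_gt0.
by apply: f_decr.2; rewrite ler_pM2l// ler_nat.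
Qed.

(** Sampling at right ends keeps the step function below [f] and avoids 0, where [f] may be
    infinite. *)
Lemma space_step_le f h m : decr f -> E f -> (0 < h)%R ->
  (h * m%:R)%:E <= alpha ->
  (N (step h (fun j : 'I_m => fine (f (h * j.+1%:R)%R)))
   <= N (trunc (h * m%:R) f))%R.
Proof.
move=> f_decr Ef h0 hm; apply: (space_le hE _ (space_trunc hE _ f_decr Ef).1 _).2.
  exact: measurable_step.
move=> t _.
case: (stepP (fun j : 'I_m => fine (f (h * j.+1%:R)%R)) t h0) => [[j jt ->]|[_ ->]];
  last by rewrite abse0 abse_ge0.
rewrite (decr_EFin_fine halpha hE)//; last by rewrite mulr_gt0.
rewrite /trunc -(cell_lt m h0 jt) ltn_ord !gee0_abs ?f_decr.1// f_decr.2//.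
by move: jt; rewrite /cell/= in_itv/= => /andP[_ /ltW].
Qed.

(* The constant step function equal to the mean of a decreasing one is majorized
   by it; this bounds the lower Riemann sums of [f] on [0, h] uniformly. *)
Lemma fundamental_integral_le f h : decr f -> E f -> (0 < h)%R ->
  h%:E <= alpha ->
  \int[mu]_(s in `[0%R, h]) f s <=
  (h * N (trunc h f) / fundamental N h)%:E.
Proof.
move=> f_decr Ef h0 ha.
have phi0 := fundamental_gt0 halpha hE h0 ha.
rewrite -integral_itv_obnd_cbnd; last exact: decr_measurable.
(* The first cell of the grid of mesh [h/(n+1)] is left out, since no sample bounds [f] there;
   monotone convergence recovers the full integral. *)
pose F n : set R := `](h / n.+1%:R)%R, h]%classic.
have FE : \bigcup_n F n = `]0%R, h]%classic.
  apply/seteqP; split => t; rewrite /F /= !in_itv/=.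
    move=> [n _] /=; rewrite in_itv/= => /andP[+ ->]; rewrite andbT.
    by apply: le_lt_trans; rewrite divr_ge0 ?ltW.
  move=> /andP[t0 th].
  have [n] := ltr_add_invr (divr_gt0 t0 h0).
  rewrite add0r => nt; exists n => //=; rewrite in_itv/= th andbT.
  by rewrite mulrC -ltr_pdivlMr.
have cvgF : \int[mu]_(x in F n) f x @[n --> \oo] -->
    \int[mu]_(x in \bigcup_n F n) f x.
  apply: ge0_nondecreasing_set_cvg_integral.
  - move=> m n mn; apply/subsetPset => t; rewrite /F /= !in_itv/= => /andP[mt ->].
    rewrite andbT; apply: le_lt_trans mt; rewrite ler_pM2l// lef_pV2 ?posrE//.
    by rewrite ler_nat ltnS.
  - by move=> n; rewrite /F.
  - by move=> n; exact: decr_measurable.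
  - by move=> n t _; exact: f_decr.1.
rewrite -FE; apply: (cvge_to_le cvgF).
apply: nearW => n.
pose d : R := (h / n.+1%:R)%R.
have d0 : (0 < d)%R by rewrite divr_gt0.
have dE : (d * n.+1%:R)%R = h by rewrite /d divfK// pnatr_eq0.
pose v (j : nat) : R := fine (f (d * j.+1%:R)%R).
have vE (j : nat) : (v j)%:E = f (d * j.+1%:R)%R.
  by rewrite /v (decr_EFin_fine halpha hE)// mulr_gt0.
have v0 j : (0 <= v j)%R by apply: fine_ge0; exact: f_decr.1.
have v_decr := fine_grid_decr f_decr Ef d0.
have dn : (d * n.+1%:R)%:E <= alpha by rewrite dE.
pose c : R := ((\sum_(j < n.+1) v j) / n.+1%:R)%R.
have c0 : (0 <= c)%R by rewrite divr_ge0// sumr_ge0.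
have cphi : (c * fundamental N h <= N (trunc h f))%R.
  rewrite (fundamentalE halpha hE)// -(scale_ind halpha hE h0 ha c0).2.
  have -> : (fun t => c%:E * ind h t) = step d (fun _ : 'I_n.+1 => c).
    apply: funext => t; rewrite indE.
    have [[j jt ->]|[tn ->]] := stepP (fun _ : 'I_n.+1 => c) t d0.
      by rewrite (mem_cell d0 jt) -dE -(cell_lt _ d0 jt) ltn_ord mule1.
    move: tn; rewrite dE => /orP[t0|ht].
      by rewrite leNgt t0 mule0.
    by rewrite (ltNge t) ht andbF mule0.
  rewrite -[in trunc _]dE; apply: le_trans (space_step_le f_decr Ef d0 dn).
  apply: (@step_majorization _ _ _ _ halpha hE d n.+1 (fun=> c) v) => //.
  move=> i im; rewrite sumr_const card_ord -mulr_natl /c mulrA ler_pdivrMr//.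
  by rewrite [leRHS]mulrC; exact: mean_decr.
(* The samples [v j] with [j < n] bound [f] on the cells after the first; the remaining one,
   [v n = f h], is nonnegative and completes the mean [c]. *)
have := @decr_sum_ge _ f d v n f_decr (ltW d0).
rewrite dE => /(_ _)/le_trans; apply; first by move=> j _; rewrite vE.
rewrite lee_fin -mulrA; apply: (@le_trans _ _ (h * c)%R).
  rewrite /c [leRHS]mulrCA -/d [leRHS]mulrC ler_wpM2l ?(ltW d0)//.
  by rewrite [leRHS]big_ord_recr/= lerDl.
by rewrite ler_pM2l// ler_pdivlMr.
Qed.

(** Up to [min(h, 1)], which is at most [alpha], the previous bound applies; beyond it [f] is
    bounded by a finite value. *)
Lemma integral_lty f h : decr f -> E f -> (0 < h)%R ->
  \int[mu]_(s in `[0%R, h]) f s < +oo.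
Proof.
move=> f_decr Ef h0.
have m0 : (0 < Num.min h 1 :> R)%R by rewrite lt_min h0 ltr01.
have mh : (Num.min h 1 <= h)%R by rewrite ge_min lexx.
rewrite (@decr_integral_split _ _ _ (Num.min h 1)%R)//; last by rewrite bnd_simp ltW.
apply: lte_add_pinfty.
  apply: (le_lt_trans (fundamental_integral_le f_decr Ef m0 _)); last exact: ltry.
  by apply: le_trans (alpha_ge1 halpha); rewrite lee_fin ge_min lexx orbT.
apply: le_lt_trans (decr_integral_le f_decr mh) _.
by rewrite -(decr_EFin_fine halpha hE f_decr Ef m0) -EFinM ltry.
Qed.

End Averaging.

(** * Submajorization in order continuous spaces *)

(** Nonnegativity is only eventual because it is applied to [phi(s) x^**(s)] as [s] tends to
    infinity, whose sign is controlled for [s > 0]. *)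
Lemma near_cvge0P {R : realType} {T : Type} {F : set_system T} {FF : Filter F}
    (f : T -> \bar R) : (\near F, 0 <= f F) ->
  f t @[t --> F] --> 0 <-> (forall e : R, (0 < e)%R -> \near F, f F <= e%:E).
Proof.
move=> f0; split=> [/fine_cvgP[ffin /cvgr0_norm_lt f_to0] e e0|f_to0].
  apply: filterS3 f0 ffin (f_to0 e e0) => t f0 ft /=.
  rewrite ger0_norm ?fine_ge0// => /ltW fte.
  by rewrite -(fineK ft) lee_fin.
apply/fine_cvgP; split.
  apply: filterS2 f0 (f_to0 1%R ltr01) => t f0 ft.
  by rewrite ge0_fin_numE//; apply: le_lt_trans ft (ltry _).
apply/cvgr0Pnorm_lt => e e0; have e20 : (0 < e / 2)%R by rewrite divr_gt0.
apply: filterS2 f0 (f_to0 _ e20) => t f0 fte /=; rewrite ger0_norm ?fine_ge0//.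
apply: (@le_lt_trans _ _ (e / 2)%R); last by lra.
have ft : f t \is a fin_num.
  by rewrite ge0_fin_numE//; apply: le_lt_trans fte (ltry _).
by rewrite -lee_fin fineK.
Qed.

Lemma cvge0P {R : realType} {T : Type} {F : set_system T} {FF : Filter F}
    (f : T -> \bar R) : (forall t, 0 <= f t) ->
  f t @[t --> F] --> 0 <-> (forall e : R, (0 < e)%R -> \near F, f F <= e%:E).
Proof. by move=> f0; apply: near_cvge0P; exact: nearW. Qed.

Section Truncation.
Context {R : realType}.
Notation mu := (@lebesgue_measure R).
Implicit Types (f : R -> \bar R) (t h : R).

(* For a decreasing [f] this is right continuity. *)
Definition rlsc f : Prop := forall t (l : R), l%:E < f t ->
  exists2 e : R, (0 < e)%R & l%:E < f (t + e)%R.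

Lemma rlsc_trunc h f : decr f -> rlsc f -> rlsc (trunc h f).
Proof.
move=> f_decr f_rlsc t l; rewrite /trunc; have [th|ht] := ltP t h => lf.
  have [e e0 le] := f_rlsc _ _ lf.
  exists (Num.min e ((h - t) / 2))%R; first by rewrite lt_min e0 divr_gt0// subr_gt0.
  have -> : (t + Num.min e ((h - t) / 2) < h)%R.
    have le2 : (Num.min e ((h - t) / 2) <= (h - t) / 2)%R by rewrite ge_min lexx orbT.
    by lra.
  by apply: lt_le_trans le (f_decr.2 _ _ _); rewrite lerD2l ge_min lexx.
exists 1%R => //; case: ifP => // _.
exact: lt_le_trans lf (f_decr.1 _).
Qed.

Lemma decr_max h f : decr f -> decr (fun t => f (Num.max t h)).
Proof.
move=> f_decr; split=> [t|s t st]; first exact: f_decr.1.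
by apply: f_decr.2; rewrite ge_max !le_max st lexx orbT.
Qed.

Lemma rlsc_max h f : decr f -> rlsc f -> rlsc (fun t => f (Num.max t h)).
Proof.
move=> f_decr f_rlsc t l /f_rlsc[e e0 le]; exists e => //.
apply: lt_le_trans le (f_decr.2 _ _ _).
rewrite ge_max lerD2r le_max lexx /= (le_trans (_ : h <= Num.max t h)%R)//.
  by rewrite le_max lexx orbT.
by rewrite lerDl ltW.
Qed.

Lemma integral_trunc h f t : decr f -> (0 <= h)%R -> (0 <= t)%R ->
  \int[mu]_(s in `[0%R, t]) trunc h f s =
  \int[mu]_(s in `[0%R, Num.min t h]) f s.
Proof.
move=> f_decr h0 t0; have tf_decr := decr_trunc h f_decr.
have below u : (u <= h)%R ->
    \int[mu]_(s in `[0%R, u]) trunc h f s = \int[mu]_(s in `[0%R, u]) f s.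
  (* The right endpoint is dropped because for [u = h] the truncation vanishes there while [f] may
     not. *)
  move=> uh; rewrite -[LHS]integral_itv_bndo_bndc; last exact: decr_measurable.
  rewrite -[RHS]integral_itv_bndo_bndc; last exact: decr_measurable.
  apply: eq_integral => s; rewrite inE/= in_itv/= => /andP[_ su].
  by rewrite /trunc (lt_le_trans su uh).
have [th|ht] := leP t h; first exact: below.
rewrite (@decr_integral_split _ _ _ h)//; last exact: ltW.
rewrite below// -[RHS]adde0; congr (_ + _).
apply/eqP; rewrite eq_le decr_integral_ge0// andbT.
apply: le_trans (decr_integral_le tf_decr (ltW ht)) _.
by rewrite /trunc ltxx mule0.
Qed.

End Truncation.

(** * Approximation by step functions and comparison of norms *)

Section OrderContinuity.
Context {R : realType} {alpha : \bar R}.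
Context {E : set (R -> \bar R)} {N : (R -> \bar R) -> R}.
Hypothesis halpha : alpha = 1 \/ alpha = +oo.
Hypothesis hE : symmetric_space alpha E N.
Hypothesis oc : order_continuous alpha E N.
Notation mu := (@lebesgue_measure R).
Implicit Types (x y z f : R -> \bar R) (h t : R).

Let bfs : banach_function_space alpha E N := hE.1.

(** A pointwise form of order continuity that exempts [t = 0] and yields membership in [E] from the
    domination. *)
Lemma oc_seq y (y_ : nat -> R -> \bar R) : E y -> (forall n, L0 alpha (y_ n)) ->
  (forall n t, dom alpha t -> (0 < t)%R -> 0 <= y_ n t <= `|y t|) ->
  (forall t, dom alpha t -> (0 < t)%R -> y_ n t @[n --> \oo] --> 0) ->
  (forall n, E (y_ n)) /\ N (y_ n) @[n --> \oo] --> 0%R.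
Proof.
move=> Ey my yy y0.
have pos t : dom alpha t -> t != 0%R -> (0 < t)%R by move=> [t0 _]; rewrite lt_def t0 => ->.
have Ey_ n : E (y_ n).
  apply: (bfs_ideal bfs _ Ey _).1 => //; apply: (@ae_on_neq _ _ 0%R) => t It tn0.
  by have /andP[yt0 yt] := yy n t It (pos _ It tn0); rewrite gee0_abs.
split=> //; apply: (oc Ey).
- move=> n; split=> //; apply: (@ae_on_neq _ _ 0%R) => t It tn0.
  by have /andP[] := yy n t It (pos _ It tn0).
- move=> n; apply: (@ae_on_neq _ _ 0%R) => t It tn0.
  by have /andP[] := yy n t It (pos _ It tn0).
- by apply: (@ae_on_neq _ _ 0%R) => t It tn0; exact: y0 (pos _ It tn0).
Qed.

(** Grids of mesh [1/(k+1)] that stay inside I and exhaust it: [k+1] cells when [alpha = 1], and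
    [(k+1)^2] cells, of total length [k+1], when [alpha] is infinite. *)
Lemma exists_grid : exists m : nat -> nat,
  [/\ forall k, (0 < m k)%N, forall k, (k.+1%:R^-1 * (m k)%:R)%:E <= alpha &
    forall t, dom alpha t -> \forall k \near \oo, (t < k.+1%:R^-1 * (m k)%:R)%R].
Proof.
have kinv (k : nat) : (k.+1%:R^-1 * k.+1%:R = 1 :> R)%R by rewrite mulVf// pnatr_eq0.
case: halpha => ->.
  exists succn; split=> // [k|t [_]]; first by rewrite kinv.
  by rewrite lte_fin => t1; apply: nearW => k; rewrite kinv.
exists (fun k => (k.+1 * k.+1)%N); split=> // [k|t [_] _]; first exact: leey.
near=> k; rewrite natrM mulrA kinv mul1r; apply: (@lt_le_trans _ _ k%:R%R).
  by near: k; exact: nbhs_infty_gtr.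
by rewrite ler_nat.
Unshelve. all: by end_near. Qed.

Lemma near_inv_le (e : R) : (0 < e)%R -> \forall k \near \oo, (k.+1%:R^-1 <= e)%R.
Proof.
move=> e0; have := near_infty_natSinv_lt (PosNum e0).
by apply: filterS => k /ltW.
Qed.

Lemma trunc_cvg0 z : decr z -> E z ->
  N (trunc k.+1%:R^-1 z) @[k --> \oo] --> 0%R.
Proof.
move=> z_decr Ez.
apply: (oc_seq (y := z) (y_ := fun k => trunc k.+1%:R^-1 z) _ _ _ _).2 => //.
- by move=> n; apply: decr_measurable; exact: decr_trunc.
- move=> n t _ _; rewrite (decr_trunc _ z_decr).1/= gee0_abs ?z_decr.1// /trunc.
  by case: ifP => // _; exact: z_decr.1.
- move=> t _ t0; apply/cvge0P => [n|e e0]; first exact: (decr_trunc _ z_decr).1.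
  near=> k; rewrite /trunc ltNge (_ : (k.+1%:R^-1 <= t)%R); first by rewrite lee_fin ltW.
  by near: k; exact: near_inv_le.
Unshelve. all: by end_near. Qed.

(** The step functions lie below [y], and the sample used at [t] is taken at most one mesh to the
    right of [t]. Right continuity gives pointwise convergence, and [oc_seq] convergence in norm. *)
Lemma step_cvg y (m : nat -> nat) : decr y -> rlsc y -> E y ->
  (forall k, (k.+1%:R^-1 * (m k)%:R)%:E <= alpha) ->
  (forall t, dom alpha t -> \forall k \near \oo, (t < k.+1%:R^-1 * (m k)%:R)%R) ->
  let y_ k := step k.+1%:R^-1 (fun j : 'I_(m k) => fine (y (k.+1%:R^-1 * j.+1%:R)%R)) in
  (forall k, E (fun t => y t - y_ k t)) /\
  N (fun t => y t - y_ k t) @[k --> \oo] --> 0%R.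
Proof.
move=> y_decr y_rlsc Ey m_le m_near y_.
have k0 (k : nat) : (0 < k.+1%:R^-1 :> R)%R by [].
have y_le k t : 0 <= y_ k t <= y t.
  rewrite /y_.
  case: (stepP (fun j : 'I_(m k) => fine (y (k.+1%:R^-1 * j.+1%:R)%R)) t (k0 k)) =>
    [[j jt ->]|[_ ->]]; last by rewrite lexx y_decr.1.
  rewrite (decr_EFin_fine halpha hE)// ?mulr_gt0// y_decr.1 y_decr.2//.
  by move: jt; rewrite /cell/= in_itv/= => /andP[_ /ltW].
have y_fin k t : y_ k t \is a fin_num by [].
apply: (oc_seq (y := y)) => //.
- move=> k; apply: emeasurable_funB; first exact: decr_measurable.
  exact: measurable_step.
- move=> k t _ t0; have /andP[yk0 yk] := y_le k t.
  rewrite gee0_abs ?y_decr.1// leeBlDr// leeDl// andbT.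
  by rewrite sube_ge0// y_fin.
- move=> t It t0; have yt := decr_fin_num halpha hE y_decr Ey t0.
  apply/cvge0P => [k|e e0].
    by have /andP[yk0 yk] := y_le k t; rewrite sube_ge0// y_fin.
  have lyt : (fine (y t) - e)%:E < y t.
    by rewrite -[ltRHS]fineK// lte_fin ltrBlDr ltrDl.
  have [d d0 yd] := y_rlsc _ _ lyt.
  near=> k.
  have tm : (t < k.+1%:R^-1 * (m k)%:R)%R by near: k; exact: m_near.
  have [j jt] := cell_exists (k0 k) (ltW t0).
  move: tm; rewrite -(cell_lt _ (k0 k) jt) => jm.
  rewrite /y_ (@step_cell _ _ _ _ (Ordinal jm) _ (k0 k) jt) /=.
  rewrite EFinN (decr_EFin_fine halpha hE) ?mulr_gt0//.
  rewrite leeBlDr; last by apply: (decr_fin_num halpha hE) => //; rewrite mulr_gt0.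
  rewrite -leeBlDl// -[y t]fineK// -EFinB; apply: le_trans (ltW yd) (y_decr.2 _ _ _).
  move: jt; rewrite /cell/= in_itv/= => /andP[jt _].
  rewrite -[j.+1%:R%R]natr1 mulrDr mulr1 lerD//.
  by near: k; exact: near_inv_le.
Unshelve. all: by end_near. Qed.

(* With [a j = y (h * (j + 1))] and
   [b j = z (h * (j + 1)) + (j == 0) * (mean of z on [0, h])], the partial sums
   of [a] are dominated by those of [b]; the extra term has norm at most that
   of [trunc h z], which vanishes with [h] by order continuity. *)
Lemma decr_majorization y z : decr y -> decr z -> rlsc y -> E y -> E z ->
  (forall t, (0 < t)%R ->
    \int[mu]_(s in `[0%R, t]) y s <= \int[mu]_(s in `[0%R, t]) z s) ->
  (N y <= N z)%R.
Proof.
move=> y_decr z_decr y_rlsc Ey Ez yz.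
have [m [m0 m_le m_near]] := exists_grid.
pose h (k : nat) : R := (k.+1%:R^-1)%R.
have h0 k : (0 < h k)%R by rewrite /h invr_gt0.
pose a k j := fine (y (h k * j.+1%:R)%R).
pose y_ k := step (h k) (fun j : 'I_(m k) => a k j).
have [Ey_ y_cvg] := step_cvg y_decr y_rlsc Ey m_le m_near.
have z_cvg := trunc_cvg0 z_decr Ez.
have le k : (N y <= N z + (N (trunc (h k) z) + N (fun t => y t - y_ k t)%E))%R.
  have h1 : (h k)%:E <= alpha.
    by apply: le_trans (alpha_ge1 halpha); rewrite lee_fin invf_le1// ler1n.
  have Eyk : E (y_ k) by exact: (space_step halpha hE _ (h0 k) (m_le k)).
  have -> : N y = N (fun t => y_ k t + (y t - y_ k t)).
    by congr N; apply: funext => t; rewrite addeC subeK.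
  apply: le_trans (bfs_normD bfs Eyk (Ey_ k)) _; rewrite addrA lerD2r.
  pose c j := fine (z (h k * j.+1%:R)%R).
  pose I := \int[mu]_(s in `[0%R, h k]) z s.
  have I_fin : I \is a fin_num.
    rewrite ge0_fin_numE; last exact: decr_integral_ge0.
    exact: (integral_lty halpha hE).
  pose b0 : R := (fine I / h k)%R.
  have b0_ge0 : (0 <= b0)%R.
    by rewrite divr_ge0 ?(ltW (h0 k))// fine_ge0// decr_integral_ge0.
  pose b j : R := (c j + (if j == 0%N then b0 else 0))%R.
  have c_ge0 j : (0 <= c j)%R by rewrite fine_ge0// z_decr.1.
  have aE j : (a k j)%:E = y (h k * j.+1%:R)%R.
    by rewrite (decr_EFin_fine halpha hE)// mulr_gt0.
  have cE j : (c j)%:E = z (h k * j.+1%:R)%R.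
    by rewrite (decr_EFin_fine halpha hE)// mulr_gt0.
  have Ec := space_step halpha hE (fun j : 'I_(m k) => c j) (h0 k) (m_le k).
  have sum_b i : (0 < i)%N -> (\sum_(j < i) b j = \sum_(j < i) c j + b0)%R.
    case: i => // i _; rewrite big_split /=; congr (_ + _)%R.
    by rewrite big_ord_recl /= big1 ?addr0.
  apply: (@le_trans _ _ (N (step (h k) (fun j : 'I_(m k) => b j)))).
    apply: (step_majorization halpha hE (h0 k) (m_le k)).
    - exact: (fine_grid_decr halpha hE y_decr Ey (h0 k)).
    - by move=> j; rewrite fine_ge0// y_decr.1.
    - by move=> j; rewrite /b addr_ge0//; case: ifP.
    case=> [|i] im; first by rewrite !big_ord0.
    rewrite sum_b// -(ler_pM2l (h0 k)) -lee_fin.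
    have hi0 : (0 < h k * i.+1%:R)%R by rewrite mulr_gt0.
    apply: le_trans (decr_sum_le y_decr (ltW (h0 k)) _) _.
      by move=> j _; rewrite aE.
    apply: le_trans (yz _ hi0) _.
    (* The integral of [z] over the first cell is [h * b0]; on the cells after it the samples [c j]
       with [j < i] suffice. *)
    rewrite (@decr_integral_split _ _ _ (h k))//; last 2 first.
    - by rewrite bnd_simp ltW.
    - by rewrite ler_peMr ?ler1n// ltW.
    rewrite mulrDr EFinD addeC; apply: leeD.
      apply: (@le_trans _ _ (h k * \sum_(j < i) c j)%:E).
        by apply: decr_sum_ge => [//||j _]; rewrite ?cE// ltW.
      by rewrite lee_fin ler_pM2l// big_ord_recr /= lerDl.
    by rewrite /b0 mulrC divfK ?gt_eqF// fineK.
  have -> : step (h k) (fun j : 'I_(m k) => b j) =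
      (fun t => step (h k) (fun j : 'I_(m k) => c j) t + b0%:E * ind (h k) t).
    apply: funext => t; rewrite /step /ind -EFinM -EFinD; congr EFin.
    rewrite -[RHS]addr0 -addrA.
    under eq_bigr do rewrite mulrDl.
    rewrite big_split /=; congr (_ + _)%R.
    rewrite (bigD1 (Ordinal (m0 k)))//= big1 ?addr0; last first.
      move=> j; rewrite -val_eqE /= => /negbTE ->; exact: mul0r.
    by rewrite /cell mulr0 mulr1.
  have [Eb Nb] := scale_ind halpha hE (h0 k) h1 b0_ge0.
  apply: le_trans (bfs_normD bfs Ec Eb) _; rewrite Nb lerD//.
    apply: le_trans (space_step_le halpha hE z_decr Ez (h0 k) (m_le k)) _.
    exact: (space_trunc hE _ z_decr Ez).2.
  rewrite -(fundamentalE halpha hE (h0 k) h1).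
  have := fundamental_integral_le halpha hE z_decr Ez (h0 k) h1.
  rewrite -/I -[I]fineK// lee_fin ler_pdivlMr; last first.
    exact: (fundamental_gt0 halpha hE).
  by rewrite /b0 mulrAC ler_pdivrMr// [(_ * h k)%R]mulrC.
apply/ler_addgt0Pr => e e0; have e20 : (0 < e / 2)%R by rewrite divr_gt0.
have [k [zk yk]] : exists k : nat, (`|N (trunc (h k) z)| < e / 2)%R /\
    (`|N (fun t => y t - y_ k t)%E| < e / 2)%R.
  apply: (@filter_ex _ \oo); apply: filterI.
  - by have /cvgr0_norm_lt/(_ _ e20) := z_cvg.
  - by have /cvgr0_norm_lt/(_ _ e20) := y_cvg.
apply: le_trans (le k) _; rewrite lerD2l.
have := ltr_normlW zk; have := ltr_normlW yk; lra.
Qed.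

End OrderContinuity.

(** * From order continuity to K-order continuity *)

Section Submajorization.
Context {R : realType} {alpha : \bar R}.
Context {E : set (R -> \bar R)} {N : (R -> \bar R) -> R}.
Hypothesis halpha : alpha = 1 \/ alpha = +oo.
Hypothesis hE : symmetric_space alpha E N.
Notation mu := (@lebesgue_measure R).
Implicit Types (x y z f : R -> \bar R) (h t : R).

Let bfs : banach_function_space alpha E N := hE.1.

Lemma submaj_integral x z : submaj alpha x z <-> forall t, (0 < t)%R ->
  \int[mu]_(s in `[0%R, t]) rearr alpha x s <=
  \int[mu]_(s in `[0%R, t]) rearr alpha z s.
Proof.
by split=> xz t t0; have := xz t t0; rewrite /maxfun lee_pmul2l// lte_fin invr_gt0.
Qed.

Lemma maxfun_ge0 x t : L0 alpha x -> (0 < t)%R -> 0 <= maxfun alpha x t.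
Proof.
move=> mx t0; rewrite mule_ge0 ?lee_fin ?invr_ge0 ?(ltW t0)//.
by apply: decr_integral_ge0; exact: decr_rearr.
Qed.

Lemma maxfun_fin x t : E x -> (0 < t)%R -> maxfun alpha x t \is a fin_num.
Proof.
move=> Ex t0; have mx := bfs_L0 bfs Ex.
apply: fin_numM => //; rewrite ge0_fin_numE.
  exact: (integral_lty halpha hE (decr_rearr mx) (space_rearr halpha hE Ex).1 t0).
by apply: decr_integral_ge0; exact: decr_rearr.
Qed.

Lemma mul_maxfun x t : (0 < t)%R -> t%:E * maxfun alpha x t =
  \int[mu]_(s in `[0%R, t]) rearr alpha x s.
Proof.
by move=> t0; rewrite /maxfun muleA -EFinM mulfV ?gt_eqF// mul1e.
Qed.

Lemma rearr_le_maxfun x t : L0 alpha x -> (0 < t)%R ->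
  rearr alpha x t <= maxfun alpha x t.
Proof.
move=> mx t0; rewrite -(@lee_pmul2l _ t%:E)// ?lte_fin// mul_maxfun//.
by apply: decr_integral0_ge; [exact: decr_rearr|exact: ltW].
Qed.

Lemma rlsc_rearr x : L0 alpha x -> rlsc (rearr alpha x).
Proof. by move=> mx t l; exact: rearr_rlsc. Qed.

Definition tail (K : R) f : R -> \bar R := f \_ `[K, +oo[.

Lemma tailE K f t : tail K f t = if (K <= t)%R then f t else 0.
Proof. by rewrite /tail patchE mem_setE in_itv/= andbT. Qed.

Lemma space_tail K x : E x -> E (tail K (rearr alpha x)) /\
  (N (tail K (rearr alpha x)) <= N (rearr alpha x))%R.
Proof.
move=> Ex; apply: (space_le hE _ (space_rearr halpha hE Ex).1 _).
  apply: measurable_funTS; apply: (measurable_restrictT _ _).1 => //.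
  by apply: decr_measurable; apply: decr_rearr; exact: bfs_L0 bfs _ Ex.
by move=> t _; rewrite tailE; case: ifP => // _; rewrite abse0 abse_ge0.
Qed.

Hypothesis oc : order_continuous alpha E N.

(** Integrating a truncation over [0, t] is integrating the function over [0, min(t, h)], so
    submajorization passes to truncations. *)
Lemma trunc_submaj_le x z h : E x -> E z -> submaj alpha x z -> (0 < h)%R ->
  (N (trunc h (rearr alpha x)) <= N (trunc h (rearr alpha z)))%R.
Proof.
move=> Ex Ez /submaj_integral xz h0.
have mx := bfs_L0 bfs Ex; have mz := bfs_L0 bfs Ez.
have dx := decr_rearr mx; have dz := decr_rearr mz.
apply: (decr_majorization halpha hE oc).
- exact: decr_trunc.
- exact: decr_trunc.
- by apply: rlsc_trunc => //; exact: rlsc_rearr.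
- exact: (space_trunc hE _ dx (space_rearr halpha hE Ex).1).1.
- exact: (space_trunc hE _ dz (space_rearr halpha hE Ez).1).1.
- move=> t t0; rewrite (integral_trunc dx (ltW h0) (ltW t0)).
  rewrite (integral_trunc dz (ltW h0) (ltW t0)).
  by apply: xz; rewrite lt_min t0.
Qed.

(* The tail of [x^*] is below [x^* (max t K)], which is submajorized by
   [z^** (K)] on [0, K) continued by [z^*]. *)
Lemma tail_submaj_le x z K : E x -> E z -> submaj alpha x z -> (0 < K)%R ->
  K%:E <= alpha ->
  (N (tail K (rearr alpha x)) <=
   fine (maxfun alpha z K) * fundamental N K + N (tail K (rearr alpha z)))%R.
Proof.
move=> Ex Ez xz K0 Ka.
have mx := bfs_L0 bfs Ex; have mz := bfs_L0 bfs Ez.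
have dx := decr_rearr mx; have dz := decr_rearr mz.
have xzK := xz K K0; move: xz => /submaj_integral xz.
have [M ME] : exists M, M = maxfun alpha z K by exists (maxfun alpha z K).
have Mfin : M \is a fin_num by rewrite ME; exact: maxfun_fin.
have M0 : 0 <= M by rewrite ME; exact: maxfun_ge0.
pose y t := rearr alpha x (Num.max t K).
have dy : decr y by exact: decr_max.
pose w t := if (t < K)%R then M else rearr alpha z t.
have dw : decr w.
  split=> [t|s t st]; rewrite /w; first by case: ifP => // _; exact: dz.1.
  have [tK|Kt] := ltP t K; first by rewrite (le_lt_trans st tK) lexx.
  case: ifP => _; last exact: dz.2.
  by rewrite ME; exact: le_trans (dz.2 _ _ Kt) (rearr_le_maxfun mz K0).
have Ey : E y.
  apply: (space_le hE _ (space_rearr halpha hE Ex).1 _).1; first exact: decr_measurable.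
  by move=> t _; rewrite !gee0_abs ?dy.1 ?dx.1// dx.2// le_max lexx.
have [EM NM] := scale_ind halpha hE K0 Ka (fine_ge0 M0).
have [Et _] := space_tail K Ez.
have wE t : dom alpha t -> w t = (fine M)%:E * ind K t + tail K (rearr alpha z) t.
  move=> [t0 _]; rewrite /w indE tailE t0 /=.
  by case: ltP => _; rewrite ?mule1 ?mule0 ?adde0 ?add0e ?fineK.
have [Ew Nw] := space_eq_ae hE (decr_measurable dw) (bfs_add bfs EM Et) (ae_onW wE).
rewrite -ME (fundamentalE halpha hE K0 Ka) -NM.
apply: le_trans (bfs_normD bfs EM Et); rewrite -Nw.
apply: (@le_trans _ _ (N y)).
  apply: (space_le hE _ Ey _).2; first exact: (bfs_L0 bfs (space_tail K Ex).1).
  move=> t _; rewrite tailE; case: ifPn => [Kt|_]; last by rewrite abse0 abse_ge0.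
  by rewrite /y max_l.
apply: (decr_majorization halpha hE oc) => //.
  by apply: rlsc_max => //; exact: rlsc_rearr.
(* Before [K], [y] is the constant [x^*(K) <= x^**(K) <= M]. From [K] on, use [y <= x^*], and that
   [w] and [z^*] have the same integral over [0, K]. *)
move=> t t0; have [tK|Kt] := ltP t K.
  apply: (@le_trans _ _ (t%:E * M)).
    rewrite -integral_itv_obnd_cbnd; last exact: decr_measurable.
    apply: le_trans (decr_integral_le dy (ltW t0)) _; rewrite subr0.
    rewrite lee_wpmul2l ?lee_fin ?(ltW t0)// /y max_r ?(ltW K0)//.
    by rewrite ME; exact: le_trans (rearr_le_maxfun mx K0) xzK.
  by have := decr_integral0_ge dw (ltW t0); rewrite {1}/w tK.
apply: (@le_trans _ _ (\int[mu]_(s in `[0%R, t]) rearr alpha x s)).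
  apply: ge0_le_integral => //; try exact: decr_measurable.
  - by move=> s _; exact: dy.1.
  - by move=> s _; apply: dx.2; rewrite le_max lexx.
apply: le_trans (xz t t0) _.
rewrite !(@decr_integral_split _ _ (BLeft 0%R) K t)// ?bnd_simp ?(ltW K0)//.
apply: leeD; last first.
  rewrite [leRHS](_ : _ = \int[mu]_(s in `]K, t]) rearr alpha z s)//.
  apply: eq_integral => s; rewrite inE/= in_itv/= => /andP[Ks _].
  by rewrite /w ltNge (ltW Ks).
rewrite -mul_maxfun// -ME -[leRHS]integral_itv_bndo_bndc; last exact: decr_measurable.
rewrite [leRHS](_ : _ = \int[mu]_(s in `[0%R, K[) cst M s); last first.
  by apply: eq_integral => s; rewrite inE/= in_itv/= => /andP[_ sK]; rewrite /w sK.
have mK : mu `[0%R, K[ = K%:E.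
  by rewrite lebesgue_measure_itv/= lte_fin K0 oppr0 adde0.
by rewrite muleC -mK -integral_cst.
Qed.

(** Convergence at a single point of ]0, min(h, 1)[ is enough, each rearrangement being
    decreasing. *)
Lemma rearr_cvg0 (x_ : nat -> R -> \bar R) h : (forall n, E (x_ n)) ->
  ae_on alpha (fun t => rearr alpha (x_ n) t @[n --> \oo] --> 0) ->
  (0 < h)%R -> rearr alpha (x_ n) h @[n --> \oo] --> 0.
Proof.
move=> Ex x0 h0; have dx n := decr_rearr (bfs_L0 bfs (Ex n)).
have [] := @ae_on_exists _ alpha 0 (Num.min h 1)%R _ _ _ _ x0 => //.
- by rewrite lt_min h0 ltr01.
- by apply: le_trans (alpha_ge1 halpha); rewrite lee_fin ge_min lexx orbT.
move=> t /andP[_]; rewrite lt_min => /andP[th _].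
move/cvge0P => /(_ (fun n => (dx n).1 t)) xt.
apply/cvge0P => [n|e e0]; first exact: (dx n).1.
by apply: filterS (xt e e0) => n; apply: le_trans; apply: (dx n).2; exact: ltW.
Qed.

Lemma tail_cvg0 x : E x -> alpha = +oo ->
  N (tail k.+1%:R (rearr alpha x)) @[k --> \oo] --> 0%R.
Proof.
move=> Ex aoo; have dx := decr_rearr (bfs_L0 bfs Ex).
have [||||_ +] := @oc_seq _ _ _ _ hE oc (rearr alpha x)
  (fun k => tail k.+1%:R (rearr alpha x)); last exact.
- exact: (space_rearr halpha hE Ex).1.
- by move=> k; exact: bfs_L0 bfs _ (space_tail _ Ex).1.
- move=> k t _ _; rewrite tailE gee0_abs ?dx.1//.
  by case: ifP => _; rewrite ?lexx ?dx.1.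
- move=> t _ _; apply: cvg_near_cst; near=> k.
  rewrite tailE leNgt (_ : (t < k.+1%:R)%R)//; apply: (@lt_le_trans _ _ k%:R).
    by near: k; exact: nbhs_infty_gtr.
  by rewrite ler_nat.
Unshelve. all: by end_near. Qed.

Lemma order_continuous_K :
  (alpha = +oo -> forall x, E x ->
      (fundamental N s)%:E * maxfun alpha x s @[s --> +oo%R] --> 0) ->
  K_order_continuous alpha E N.
Proof.
move=> phi0 x Ex x_ Ex_ xx x_0.
apply/cvgr0Pnorm_lt => e e0; have e30 : (0 < e / 3)%R by rewrite divr_gt0.
have dx := decr_rearr (bfs_L0 bfs Ex).
have [h h0 xh] : exists2 h, (0 < h)%R & (N (trunc h (rearr alpha x)) < e / 3)%R.
  have /cvgr0_norm_lt/(_ _ e30) := trunc_cvg0 hE oc dx (space_rearr halpha hE Ex).1.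
  move=> /(@filter_ex _ \oo)[k /ltr_normlW xk].
  by exists (k.+1%:R^-1)%R.
have [K [K0 Ka xK]] : exists K : R, [/\ (0 < K)%R, K%:E <= alpha &
    forall n, (N (tail K (rearr alpha (x_ n))) <= e / 3)%R].
  case: halpha => [a1|aoo].
    (* For [alpha = 1] the tail from 1 on vanishes on I, so it has the norm of the zero function. *)
    exists 1%R; split; [by []|by rewrite a1|move=> n].
    suff [_ ->] : E (tail 1 (rearr alpha (x_ n))) /\
        N (tail 1 (rearr alpha (x_ n))) = N (fun t => 0%:E * x t).
      by rewrite (bfs_normZ bfs)// normr0 mul0r ltW.
    apply: (space_eq_ae hE _ (bfs_scale bfs 0%R Ex) _).
      exact: bfs_L0 bfs _ (space_tail _ (Ex_ n)).1.
    apply: ae_onW => t [_]; rewrite a1 lte_fin => t1.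
    by rewrite tailE leNgt t1 mul0e.
  have e60 : (0 < e / 6)%R by rewrite divr_gt0.
  have phi_ge0 : \forall s \near +oo%R, 0 <= (fundamental N s)%:E * maxfun alpha x s.
    near=> s; have s0 : (0 < s)%R by near: s; exact: nbhs_pinfty_gt.
    rewrite mule_ge0 ?lee_fin ?maxfun_ge0//; last exact: bfs_L0 bfs _ Ex.
    by rewrite ltW// (fundamental_gt0 halpha hE)// aoo leey.
  have /(near_cvge0P phi_ge0)/(_ _ e60)[A [_ phiA]] := phi0 aoo x Ex.
  have [k [Ak xk]] : exists k : nat, (A < k.+1%:R)%R /\
      (`|N (tail k.+1%:R (rearr alpha x))| < e / 6)%R.
    apply: (@filter_ex _ \oo); apply: filterI.
    - apply: filterS (nbhs_infty_gtr A) => k /lt_trans; apply.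
      by rewrite ltr_nat.
    - by have /cvgr0_norm_lt/(_ _ e60) := tail_cvg0 Ex aoo.
  have K0 : (0 < k.+1%:R :> R)%R by [].
  have Ka : k.+1%:R%:E <= alpha by rewrite aoo leey.
  exists k.+1%:R%R; split=> // n.
  apply: le_trans (tail_submaj_le (Ex_ n) Ex (xx n) K0 Ka) _.
  have := phiA _ Ak; rewrite -(fineK (maxfun_fin Ex K0)) -EFinM lee_fin mulrC.
  by have := ltr_normlW xk; lra.
have dx_ n := decr_rearr (bfs_L0 bfs (Ex_ n)).
have phiK := fundamental_gt0 halpha hE K0 Ka.
have phiK1 : (0 < fundamental N K + 1)%R by rewrite addr_gt0.
(* Once [c = x_n^*(h) <= d], the middle term has norm [c * phi(K) <= e / 3]. *)
pose d := (e / 3 / (fundamental N K + 1))%R.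
have d0 : (0 < d)%R by rewrite divr_gt0.
have := rearr_cvg0 Ex_ x_0 h0; move/cvge0P => /(_ (fun n => (dx_ n).1 h))/(_ _ d0).
apply: filterS => n xd; rewrite ger0_norm; last exact: (N_ge0 hE (Ex_ n)).
pose r := rearr alpha (x_ n); pose c := fine (r h).
have c0 : (0 <= c)%R by rewrite fine_ge0// (dx_ n).1.
have [Er Nr] := space_rearr halpha hE (Ex_ n).
have cE : c%:E = r h by rewrite (decr_EFin_fine halpha hE (dx_ n) Er h0).
have [Eh _] := space_trunc hE h (dx_ n) Er.
have [EK NK] := scale_ind halpha hE K0 Ka c0.
have [Et _] := space_tail K (Ex_ n).
have EKt := bfs_add bfs EK Et.
rewrite -Nr; apply: (@le_lt_trans _ _ (N (fun t =>
    trunc h r t + (c%:E * ind K t + tail K r t)))).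
  apply: (space_le hE _ (bfs_add bfs Eh EKt) _).2; first exact: bfs_L0 bfs _ Er.
  move=> t [t0 _]; have cK0 : 0 <= c%:E * ind K t.
    by rewrite mule_ge0 ?lee_fin// indE; case: ifP.
  have tr0 : 0 <= trunc h r t by exact: (decr_trunc h (dx_ n)).1.
  have ta0 : 0 <= tail K r t by rewrite tailE; case: ifP => // _; exact: (dx_ n).1.
  rewrite !gee0_abs ?adde_ge0 ?(dx_ n).1//.
  (* One of the three terms dominates at each [t]: the tail from [K] on, the truncation before [h],
     and otherwise the constant, as [x_n^*(t) <= x_n^*(h) = c]. *)
  have [Kt|tK] := leP K t.
    by rewrite [tail _ _ _]tailE Kt addeA leeDr// adde_ge0.
  have [th|ht] := ltP t h; first by rewrite {1}/trunc th leeDl// adde_ge0.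
  apply: (@le_trans _ _ (c%:E * ind K t)).
    by rewrite indE t0 tK mule1 cE; exact: (dx_ n).2.
  by rewrite addeCA leeDl// adde_ge0.
apply: le_lt_trans (bfs_normD bfs Eh EKt) _.
have := bfs_normD bfs EK Et; rewrite NK -(fundamentalE halpha hE K0 Ka).
have := trunc_submaj_le (Ex_ n) Ex (xx n) h0; have := xK n; rewrite -/r.
have cphi : (c * fundamental N K <= e / 3)%R.
  apply: (@le_trans _ _ (d * (fundamental N K + 1))%R); last first.
    by rewrite /d divfK// gt_eqF.
  by rewrite ler_pM ?(ltW phiK)// ?lerDl// -lee_fin cE.
lra.
Unshelve. all: by end_near. Qed.

End Submajorization.

(** * K-order continuous spaces *)

Section KOrderContinuity.
Context {R : realType} {alpha : \bar R}.
Context {E : set (R -> \bar R)} {N : (R -> \bar R) -> R}.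
Hypothesis halpha : alpha = 1 \/ alpha = +oo.
Hypothesis hE : symmetric_space alpha E N.
Notation mu := (@lebesgue_measure R).
Implicit Types (x y z f : R -> \bar R) (h t s : R).

Let bfs : banach_function_space alpha E N := hE.1.

(** The limit at infinity of a decreasing function is its infimum. *)
Lemma rearr_infty0P x : alpha = +oo -> L0 alpha x ->
  rearr_infty alpha x = 0 <->
  (forall e : R, (0 < e)%R -> exists2 T, (0 < T)%R & rearr alpha x T <= e%:E).
Proof.
move=> aoo mx; have dx := decr_rearr mx.
have xcvg : rearr alpha x t @[t --> +oo%R] --> ereal_inf (range (rearr alpha x)).
  by apply: nonincreasing_cvge => s t; exact: dx.2.
rewrite /rearr_infty aoo eqxx; rewrite aoo in xcvg dx.
have -> := cvg_lim (@ereal_hausdorff R) xcvg.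
split=> [x0 e e0|x_le].
  have /ereal_inf_lt[_ [t _ <-] /ltW te] : ereal_inf (range (rearr +oo x)) < e%:E.
    by rewrite x0 lte_fin.
  exists (Num.max t 1)%R; first by rewrite lt_max ltr01 orbT.
  by apply: le_trans te; apply: dx.2; rewrite le_max lexx.
apply/eqP; rewrite eq_le; apply/andP; split.
  apply/lee_addgt0Pr => e e0; rewrite add0e; have [T _ xT] := x_le e e0.
  by apply: le_trans xT; apply: ereal_inf_lbound; exists T.
by apply/ereal_infP => _ [t _ <-]; exact: dx.1.
Qed.

(** For [s >= 1] one has [phi(1) x^*(s) <= phi(s) x^**(s)], and [phi(1) > 0]. *)
Lemma rearr_infty_eq0 x : alpha = +oo -> E x ->
  (fundamental N s)%:E * maxfun alpha x s @[s --> +oo%R] --> 0 ->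
  rearr_infty alpha x = 0.
Proof.
move=> aoo Ex phi0; have mx := bfs_L0 bfs Ex.
have phi_gt0 s : (0 < s)%R -> (0 < fundamental N s)%R.
  by move=> s0; apply: (fundamental_gt0 halpha hE) => //; rewrite aoo leey.
apply/(rearr_infty0P aoo mx) => e e0.
have near_ge0 : \forall s \near +oo%R, 0 <= (fundamental N s)%:E * maxfun alpha x s.
  near=> s; have s0 : (0 < s)%R by near: s; exact: nbhs_pinfty_gt.
  by rewrite mule_ge0 ?maxfun_ge0// lee_fin ltW// phi_gt0.
have c0 : (0 < fundamental N 1 * e)%R by rewrite mulr_gt0// phi_gt0.
have [A [_ phiA]] := (near_cvge0P near_ge0).1 phi0 _ c0.
pose s := (Num.max A 0 + 1)%R.
have As : (A < s)%R by rewrite ltr_pwDr// le_max lexx.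
have s1 : (1 <= s)%R by rewrite lerDr le_max lexx orbT.
have s0 : (0 < s)%R by exact: lt_le_trans s1.
exists s => //; rewrite -(@lee_pmul2l _ (fundamental N 1)%:E)//; last first.
  by rewrite lte_fin phi_gt0.
rewrite -EFinM; apply: le_trans (phiA _ As).
apply: lee_pmul; [by rewrite lee_fin ltW ?phi_gt0|exact: (decr_rearr mx).1| |].
  by rewrite lee_fin; apply: (fundamental_le halpha hE) => //; rewrite aoo leey.
exact: rearr_le_maxfun.
Unshelve. all: by end_near. Qed.

(** Dominated convergence for the indicators of the superlevel sets, all below that of [x], which is
    integrable since [d_x(l)] is finite. *)
Lemma distr_cvg0 (x_ : nat -> R -> \bar R) x l : (0 < l)%R ->
  (forall n, L0 alpha (x_ n)) -> L0 alpha x -> distr alpha x l < +oo ->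
  ae_on alpha (fun t => forall n, 0 <= x_ n t /\ x_ n t <= `|x t|) ->
  ae_on alpha (fun t => x_ n t @[n --> \oo] --> 0) ->
  distr alpha (x_ n) l @[n --> \oo] --> 0.
Proof.
move=> l0 mx_ mx xl x_x x_0.
pose A (y : R -> \bar R) := [set t | dom alpha t /\ l%:E < `|y t|].
have mA y : L0 alpha y -> measurable (A y) by exact: measurable_superlevel.
have AE y : L0 alpha y ->
    \int[mu]_(t in dom alpha) (\1_(A y) t)%:E = distr alpha y l.
  move=> my; rewrite integral_indic//; [|exact: measurable_dom|exact: mA].
  by congr (mu _); apply/seteqP; split=> t [] // [].
have [|||||_ _] := @dominated_convergence _ _ R mu (dom alpha) (measurable_dom alpha)
  (fun n t => (\1_(A (x_ n)) t)%:E) (cst 0) (fun t => (\1_(A x) t)%:E).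
- by move=> n; apply/measurable_EFinP; apply: measurable_indic; exact: mA.
- exact: measurable_cst.
- apply: ae_on_imp (ae_on_and x_x x_0) => t It [xx /cvge0P].
  move=> /(_ (fun n => (xx n).1))/(_ _ l0) xt.
  apply: cvg_near_cst; apply: filterS xt => n xnl; rewrite indicE memNset//.
  by move=> [_]; rewrite gee0_abs ?(xx n).1// ltNge xnl.
- apply/integrableP; split.
    by apply/measurable_EFinP; apply: measurable_indic; exact: mA.
  by under eq_integral do rewrite gee0_abs ?lee_fin//; rewrite AE.
- move: x_x; apply: (@filterS _ _ (ae_filter_ringOfSetsType mu)) => t xx n It.
  have [x0 xnx] := xx It n.
  rewrite gee0_abs ?lee_fin// !indicE.
  case: (boolP (t \in A (x_ n))) => // /set_mem[_ lxn].
  rewrite mem_set//; split=> //; apply: lt_le_trans xnx.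
  by rewrite -(gee0_abs x0).
rewrite integral0 => A0.
rewrite (_ : (fun n => distr alpha (x_ n) l) =
  (fun n => \int[mu]_(t in dom alpha) (\1_(A (x_ n)) t)%:E))//.
by apply: funext => n; rewrite AE.
Qed.

Lemma K_order_continuous_oc :
  (alpha = +oo -> forall x, E x -> rearr_infty alpha x = 0) ->
  K_order_continuous alpha E N -> order_continuous alpha E N.
Proof.
move=> x_infty Koc x Ex x_ pos x_x x_0.
have mx := bfs_L0 bfs Ex; have Ex_ n := (pos n).1.
have mx_ n := bfs_L0 bfs (Ex_ n).
have xx : ae_on alpha (fun t => forall n, 0 <= x_ n t /\ x_ n t <= `|x t|).
  by apply: ae_on_forall => n; apply: ae_on_and; [exact: (pos n).2|exact: x_x].
have distr_fin l : (0 < l)%R -> distr alpha x l < +oo.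
  move=> l0; case: halpha => [a1|aoo].
    apply: le_lt_trans (distr_le_alpha _ _ mx) _; rewrite a1 ?ltry//.
  have [T _] := (rearr_infty0P aoo mx).1 (x_infty aoo x Ex) l l0.
  by rewrite rearr_leP ?(ltW l0)// => /le_lt_trans; apply; exact: ltry.
apply: (Koc x Ex) => //.
- move=> n; apply/submaj_integral => t t0.
  apply: ge0_le_integral => //; try by apply: decr_measurable; exact: decr_rearr.
  + by move=> s _; exact: (decr_rearr (mx_ n)).1.
  + move=> s _; apply: rearr_le_mono => //.
    by apply: ae_on_imp xx => r _ /(_ n)[x0 xnx]; rewrite gee0_abs.
- apply: (@ae_on_neq _ _ 0%R) => t [t0 _] tn0.
  have {tn0} {}t0 : (0 < t)%R by rewrite lt_def tn0.
  apply/cvge0P => [n|e e0]; first exact: (decr_rearr (mx_ n)).1.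
  (* The point [t > 0] itself serves as tolerance: a distribution function at most [t] at level [e]
     means [x_n^*(t) <= e]. *)
  have /cvge0P := distr_cvg0 e0 mx_ mx (distr_fin e e0) xx x_0.
  move=> /(_ (fun n => distr_ge0 _ _ _))/(_ _ t0).
  by apply: filterS => n; rewrite rearr_leP// ltW.
Qed.

(** [t x^**(t)] is [s x^**(s)] plus the integral of [x^*] over ]s, t], where
    [x^* <= x^*(s) <= x^**(s)]. *)
Lemma maxfun_decr x s t : L0 alpha x -> (0 < s)%R -> (s <= t)%R ->
  maxfun alpha x t <= maxfun alpha x s.
Proof.
move=> mx s0 st; have t0 : (0 < t)%R by exact: lt_le_trans st.
have dx := decr_rearr mx.
rewrite -(@lee_pmul2l _ t%:E)// ?lte_fin// mul_maxfun//.
rewrite (@decr_integral_split _ _ _ s)// ?bnd_simp ?(ltW s0)//.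
have -> : t%:E = s%:E + (t - s)%:E by rewrite -EFinD addrC subrK.
rewrite -mul_maxfun// ge0_muleDl ?lee_fin ?subr_ge0 ?(ltW s0)//.
rewrite leeD2l//; apply: le_trans (decr_integral_le dx st) _.
by rewrite lee_wpmul2l ?lee_fin ?subr_ge0// rearr_le_maxfun.
Qed.

(** A Cesaro argument: cut the mean at [T] with [x^*(T) <= e / 2]. The part over [0, T] is a fixed
    finite [C], and [C / t <= e / 2] for large [t]. *)
Lemma maxfun_cvg0 x : alpha = +oo -> E x -> rearr_infty alpha x = 0 ->
  maxfun alpha x t @[t --> +oo%R] --> 0.
Proof.
move=> aoo Ex; have mx := bfs_L0 bfs Ex; have dx := decr_rearr mx.
move/(rearr_infty0P aoo mx) => x0.
have near_ge0 : \forall s \near +oo%R, 0 <= maxfun alpha x s.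
  near=> s; have s0 : (0 < s)%R by near: s; exact: nbhs_pinfty_gt.
  exact: maxfun_ge0.
apply/(near_cvge0P near_ge0) => e e0.
have e20 : (0 < e / 2)%R by rewrite divr_gt0.
have [T T0 xT] := x0 _ e20.
have MT := maxfun_fin halpha hE Ex T0.
pose C := (T * fine (maxfun alpha x T))%R.
near=> t.
have tT : (T <= t)%R by near: t; apply: nbhs_pinfty_ge; exact: num_real.
have t0 : (0 < t)%R by exact: lt_le_trans tT.
have tC : (C / (e / 2) <= t)%R by near: t; apply: nbhs_pinfty_ge; exact: num_real.
rewrite -(@lee_pmul2l _ t%:E)// ?lte_fin// mul_maxfun//.
rewrite (@decr_integral_split _ _ _ T)// ?bnd_simp ?(ltW T0)//.
rewrite -mul_maxfun// -(fineK MT) -EFinM -/C.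
apply: (@le_trans _ _ (C%:E + ((t - T) * (e / 2))%:E)).
  rewrite leeD2l//; apply: le_trans (decr_integral_le dx tT) _.
  by rewrite EFinM lee_wpmul2l ?lee_fin ?subr_ge0.
rewrite -EFinD -EFinM lee_fin; move: tC; rewrite ler_pdivrMr//.
have : (0 <= T * (e / 2))%R by rewrite mulr_ge0 ?ltW.
by move=> h1 h2; nra.
Unshelve. all: by end_near. Qed.

(** By [rearr_leP]: the distribution function is 0 at level [c], and at most [s] at level 0. *)
Lemma rearr_scale_ind_le (c s t : R) : (0 <= c)%R -> (0 < s)%R -> (0 <= t)%R ->
  rearr alpha (fun u => c%:E * ind s u) t <= trunc s (cst c%:E) t.
Proof.
move=> c0 s0 t0.
have mcs : L0 alpha (fun u => c%:E * ind s u).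
  by apply: emeasurable_funM; [exact: measurable_cst|exact: measurable_ind].
rewrite /trunc; case: ltP => [ts|st] /=; rewrite rearr_leP//.
  rewrite (_ : distr _ _ _ = 0) ?lee_fin//.
  rewrite /distr (_ : [set _ | _] = set0) ?measure0// -subset0 => u [_].
  change (c%:E < `|c%:E * ind s u| -> False); rewrite indE; case: ifP => _.
    by rewrite mule1 abse_EFin ger0_norm// ltxx.
  by rewrite mule0 abse0 lte_fin ltNge c0.
apply: (@le_trans _ _ s%:E); last by rewrite lee_fin.
rewrite -[leRHS](@mu_halfline _ s%:E) ?lee_fin ?(ltW s0)//.
apply: le_measure; rewrite ?inE.
- exact: measurable_superlevel.
- by have := measurable_dom s%:E.
- move=> u [[u0 _]]; change (0 < `|c%:E * ind s u| -> (0 <= u)%R /\ u%:E < s%:E).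
  rewrite indE u0 lte_fin andTb; case: (ltP u s) => // _.
  by rewrite mule0 abse0 ltxx.
Qed.

(** With [m = min(t, s)], the left integral over [0, t] is at most [m x^**(s) <= m x^**(m)], the
    integral of [x^*] over [0, m]. *)
Lemma scale_ind_submaj x s : E x -> (0 < s)%R ->
  submaj alpha (fun u => (fine (maxfun alpha x s))%:E * ind s u) x.
Proof.
move=> Ex s0; have mx := bfs_L0 bfs Ex; have dx := decr_rearr mx.
have cfin := maxfun_fin halpha hE Ex s0.
have c0 : (0 <= fine (maxfun alpha x s))%R by rewrite fine_ge0// maxfun_ge0.
have mcs : L0 alpha (fun u => (fine (maxfun alpha x s))%:E * ind s u).
  by apply: emeasurable_funM; [exact: measurable_cst|exact: measurable_ind].
have dc : decr (cst (fine (maxfun alpha x s))%:E) by split=> // t; rewrite lee_fin.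
apply/submaj_integral => t t0.
apply: (@le_trans _ _ (\int[mu]_(u in `[0%R, t])
    trunc s (cst (fine (maxfun alpha x s))%:E) u)).
  apply: ge0_le_integral => //.
  - by move=> u _; exact: (decr_rearr mcs).1.
  - by apply: decr_measurable; exact: decr_rearr.
  - by apply: decr_measurable; exact: decr_trunc.
  - move=> u; rewrite /= in_itv/= => /andP[u0 _]; exact: rearr_scale_ind_le.
rewrite (integral_trunc dc (ltW s0) (ltW t0)).
have m0 : (0 < Num.min t s)%R by rewrite lt_min t0.
rewrite -[leLHS](integral_itv_obnd_cbnd); last exact: decr_measurable.
have -> : \int[mu]_(u in `]0%R, Num.min t s]) (cst (fine (maxfun alpha x s))%:E) u =
    (Num.min t s)%:E * maxfun alpha x s.
  by rewrite -[X in X%:E * _](subr0 (Num.min t s)) -(mu_oc (ltW m0)) muleC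
    -[in RHS](fineK cfin) -integral_cst.
apply: (@le_trans _ _ (\int[mu]_(u in `[0%R, Num.min t s]) rearr alpha x u)).
  rewrite -mul_maxfun// lee_wpmul2l ?lee_fin ?(ltW m0)//.
  by apply: maxfun_decr => //; rewrite ge_min lexx orbT.
apply: ge0_subset_integral => //; first exact: decr_measurable.
- by move=> u _; exact: dx.1.
- move=> u; rewrite /= !in_itv/= => /andP[-> um] /=.
  by apply: le_trans um _; rewrite ge_min lexx.
Qed.

Lemma K_order_continuous_fundamental x : alpha = +oo -> E x ->
  rearr_infty alpha x = 0 -> K_order_continuous alpha E N ->
  (fundamental N s)%:E * maxfun alpha x s @[s --> +oo%R] --> 0.
Proof.
move=> aoo Ex x0 Koc; have mx := bfs_L0 bfs Ex.
apply/cvge_pinftyP => u u_oo.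
(* The first terms of [u] may be nonpositive; [s] is always positive and eventually equals [u]. *)
pose s n := Num.max (u n) 1%R.
have s_gt0 n : (0 < s n)%R by rewrite lt_max ltr01 orbT.
have sa n : (s n)%:E <= alpha by rewrite aoo leey.
have s_oo : s n @[n --> \oo] --> +oo%R.
  apply/cvgryPge => A; have /cvgryPge/(_ A) := u_oo.
  by apply: filterS => n An; rewrite le_max An.
pose c n := fine (maxfun alpha x (s n)).
have cE n : (c n)%:E = maxfun alpha x (s n) by rewrite fineK// (maxfun_fin halpha hE).
have c0 n : (0 <= c n)%R by rewrite fine_ge0// maxfun_ge0.
pose x_ n t := (c n)%:E * ind (s n) t.
have Ex_ n : E (x_ n) by exact: (scale_ind halpha hE (s_gt0 n) (sa n) (c0 n)).1.
have /cvge_pinftyP/(_ _ s_oo) := maxfun_cvg0 aoo Ex x0.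
move=> /cvge0P => /(_ (fun n => maxfun_ge0 mx (s_gt0 n))) maxfun0.
have Nx_ : N (x_ n) @[n --> \oo] --> 0%R.
  apply: (Koc x Ex) => //; first by move=> n; exact: scale_ind_submaj.
  (* The rearrangement of [x_ n] is bounded by the constant [x^**(s n)], which tends to 0. *)
  apply: ae_onW => t [t0 _].
  apply/cvge0P => [n|e e0]; first exact: (decr_rearr (bfs_L0 bfs (Ex_ n))).1.
  apply: filterS (maxfun0 e e0) => n; apply: le_trans.
  apply: le_trans (rearr_scale_ind_le (c0 n) (s_gt0 n) t0) _.
  by rewrite /trunc -cE; case: ifP => // _; rewrite lee_fin.
have {Nx_} NE : (N (x_ n))%:E @[n --> \oo] --> 0 by apply: cvg_EFin; [exact: nearW|].
apply: cvg_trans NE; apply: near_eq_cvg.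
have /cvgryPge/(_ 1%R) := u_oo; apply: filterS => n u1.
have sn : s n = u n by rewrite /s max_l.
rewrite (scale_ind halpha hE (s_gt0 n) (sa n) (c0 n)).2.
rewrite -(fundamentalE halpha hE (s_gt0 n) (sa n)) EFinM cE sn.
by rewrite muleC.
Qed.

End KOrderContinuity.

Theorem corollary4p9 (R : realType) (alpha : \bar R)
    (E : set (R -> \bar R)) (N : (R -> \bar R) -> R)
    (halpha : alpha = 1 \/ alpha = +oo)
    (hE : symmetric_space alpha E N)
    (hF : fatou_property alpha E N) :
  (order_continuous alpha E N /\
   (alpha = +oo -> forall x, E x ->
      (fundamental N s)%:E * maxfun alpha x s @[s --> +oo%R] --> 0))
  <->
  (K_order_continuous alpha E N /\
   (alpha = +oo -> forall x, E x -> rearr_infty alpha x = 0)).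
Proof.
split=> [[oc phi0]|[Koc x_infty]]; split.
- exact: (order_continuous_K halpha hE oc).
- by move=> aoo x Ex; apply: (rearr_infty_eq0 halpha hE) => //; exact: phi0.
- exact: (K_order_continuous_oc halpha hE).
- move=> aoo x Ex; apply: (K_order_continuous_fundamental halpha hE) => //.
  exact: x_infty.
Qed.
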